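(* Let $\mathcal D$ be a Hermann foliation on $M$ that admits two universal Lie $\infty$-algebroids $(E,Q_E)$ and $(F,Q_F)$ resolving it. Then, for every $x\in M$, the holonomy graded Lie algebras at $x$, computed with respect to these structures, are canonically isomorphic.
   Context: Let $\mathscr O$ be the sheaf of functions on $M$ (smooth, real analytic or holomorphic), $\mathfrak X$ the sheaf of vector fields, $\Gamma(\cdot)$ sheaves of sections. Hermann foliation: a sub-sheaf $\mathcal D\subset\mathfrak X$, locally finitely generated over $\mathscr O$ and closed under the Lie bracket. Lie $\infty$-algebroid $(E,Q)$ over $M$: a sequence $E=(E_{-i})_{i\ge1}$ of finite-rank vector bundles over $M$ ($E_{-i}$ in degree $-i$) and a degree $+1$ derivation $Q$, $Q^2=0$, of $\mathscr E=\Gamma(S(E^* ))$ (sections of $E_{-i}^*$ have degree $i$). Elements of $\Gamma(S^n(E^* ))$ have arity $n$; $Q^{(0)}$ is the arity-preserving component. Anchor $\rho:E_{-1}\to TM$: $\langle Q[f],x\rangle=\rho(x)[f]$. Linear part: $\mathrm d^{(i)}:E_{-i}\to E_{-i+1}$ ($i\ge2$), $\langle Q^{(0)}[\alpha],x\rangle=(-1)^{i-1}\langle\alpha,\mathrm d^{(i)}x\rangle$. Brackets on $\Gamma(E)$, graded symmetric of degree $+1$: $\{x_1,\dots,x_n\}_n=\Pi([\dots[Q,\partial_{x_1}],\dots,\partial_{x_n}])$, where $\partial_x$ is the $\mathscr O$-linear derivation given by contraction with $x$ and $\Pi$ projects to the fiberwise constant component (identified with a section of $E$). $(E,Q)$ is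 universal resolving $\mathcal D$ if $\rho(\Gamma(E_{-1}))=\mathcal D$ and $\cdots\to\Gamma(E_{-2})\xrightarrow{\mathrm d^{(2)}}\Gamma(E_{-1})\xrightarrow{\rho}\mathcal D\to0$ is an exact sequence of sheaves. Holonomy graded Lie algebra at $x$: the brackets of $(E,Q)$ restrict to an $L_\infty$-algebra structure on $\ker(\rho_x)\oplus\bigoplus_{i\ge2}E_{-i}|_x$ (take the bracket of extending sections and evaluate at $x$), with differential given by the complex $\cdots\to E_{-3}|_x\xrightarrow{\mathrm d^{(3)}}E_{-2}|_x\xrightarrow{\mathrm d^{(2)}}\ker(\rho_x)$. Its cohomology $H_{\mathcal D}(x)=\bigoplus_{i\ge1}H^{-i}_{\mathcal D}(x)$, with the bracket induced by the binary bracket, is a graded Lie algebra (symmetric convention: graded symmetric bracket of degree $+1$ satisfying the graded Jacobi identity). ''Canonically'' means that the isomorphism does not depend on choices: it is induced by the linear part of any Lie $\infty$-algebroid morphism over $\mathrm{id}_M$ between the two (an $\mathscr O$-linear degree $0$ algebra morphism of the sheaves of functions intertwining the homological vector fields). *)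

(* Defs.v *)
From HB Require Import structures.
From mathcomp Require Import all_boot all_order all_algebra ring_quotient.
From mathcomp Require Import all_classical all_reals all_analysis.
From mathcomp Require Import complex.

Set Implicit Arguments.
Unset Strict Implicit.
Unset Printing Implicit Defensive.

Import Order.TTheory GRing.Theory Num.Theory.
Import numFieldNormedType.Exports.

Local Open Scope classical_set_scope.
Local Open Scope ring_scope.
Local Open Scope quotient_scope.

(* Conventions.
   - A sheaf of set-theoretic sections is given by a predicate "s is a section
     of the sheaf on some neighbourhood of x" on pairs (s, x), where s is
     defined on all of M but only its germ at x matters: the sections over an
     open U are the s satisfying the predicate at every x in U (modulo equality
     on U).
   - A sheaf morphism is an operator on such total s whose value at x only
     depends on the germ of s at x, whenever s is a section near x.
   - The graded component of degree -(i+1), i >= 0, has index i : nat. *)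

(* The quotient of a subspace Z by its subspace of vectors lying in B *)

Section SubQuotient.
Context {K : fieldType} {V : lmodType K} (Z B : submodClosed V).

Definition subspace := {v : V | v \in Z}.
HB.instance Definition _ := SubType.on subspace.
HB.instance Definition _ := [Choice of subspace by <:].
HB.instance Definition _ := [SubChoice_isSubLmodule of subspace by <:].

Definition sub_pred : {pred subspace} := [pred z | val z \in B].

Fact sub_pred_closed : submod_closed sub_pred.
Proof.
split=> [|a u v]; rewrite !inE ?raddf0 ?rpred0 // => uB vB.
by rewrite linearP rpredD // rpredZ.
Qed.
HB.instance Definition _ := GRing.isSubmodClosed.Build K subspace sub_pred
  sub_pred_closed.

Definition subquot := Quotient.quot sub_pred.
HB.instance Definition _ := GRing.Zmodule.on subquot.
HB.instance Definition _ := EqQuotient.on subquot.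

Definition cls (z : subspace) : subquot := \pi_(Quotient.quot sub_pred) z.

Fact cls_eq u v : (cls u == cls v) = (u - v \in sub_pred).
Proof. by rewrite /cls piE. Qed.

Fact clsD u v : cls (u + v) = cls u + cls v.
Proof. by rewrite /cls raddfD. Qed.

Definition sq_scale (a : K) (q : subquot) : subquot := cls (a *: repr q).

Fact sq_scale_cls a u : sq_scale a (cls u) = cls (a *: u).
Proof.
apply/eqP; rewrite /sq_scale cls_eq -scalerBr rpredZ //.
by rewrite -cls_eq /cls reprK.
Qed.

Fact cls_surj q : {u | q = cls u}.
Proof. by exists (repr q); rewrite /cls reprK. Qed.

Fact sq_scaleA a b q : sq_scale a (sq_scale b q) = sq_scale (a * b) q.
Proof. by have [u ->] := cls_surj q; rewrite !sq_scale_cls scalerA. Qed.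
Fact sq_scale1 : left_id 1 sq_scale.
Proof. by move=> q; have [u ->] := cls_surj q; rewrite !sq_scale_cls scale1r. Qed.
Fact sq_scaleDr : right_distributive sq_scale +%R.
Proof.
move=> a p q; have [u ->] := cls_surj p; have [v ->] := cls_surj q.
by rewrite -clsD !sq_scale_cls scalerDr clsD.
Qed.
Fact sq_scaleDl q : {morph sq_scale^~ q : a b / a + b}.
Proof.
by move=> a b; have [u ->] := cls_surj q; rewrite !sq_scale_cls scalerDl clsD.
Qed.
HB.instance Definition _ := GRing.Zmodule_isLmodule.Build K subquot
  sq_scaleA sq_scale1 sq_scaleDr sq_scaleDl.

End SubQuotient.

Variant geometry := Smooth | RealAnalytic | Holomorphic.

Definition complexes (R : realType) : numFieldType := R[i].

Definition scalars (R : realType) (c : geometry) : numFieldType :=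
  match c with
  | Holomorphic => complexes R
  | _ => R : numFieldType
  end.

Fixpoint is_Ck (R : realType) n (k : nat) (U : set 'rV[R]_n)
    (g : 'rV[R]_n -> R) : Prop :=
  (forall p, U p -> {for p, continuous g}) /\
  match k with
  | 0 => True
  | k'.+1 => forall j : 'I_n, let e : 'rV[R]_n := delta_mx 0 j in
      (forall p, U p -> derivable g p e) /\ is_Ck k' U ('D_e g)
  end.

Definition smooth_at (R : realType) n (g : 'rV[R]_n -> R) (p : 'rV[R]_n) :=
  exists U, [/\ open U, U p & forall k, is_Ck k U g].

Definition monomial (R : realType) n (a : 'I_n -> nat) (h : 'rV[R]_n) : R :=
  \prod_(j < n) h 0 j ^+ a j.

Definition power_series_at (R : realType) n (g : 'rV[R]_n -> R)
    (p : 'rV[R]_n) :=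
  exists (coef : ('I_n -> nat) -> R) (r C : R),
    [/\ 0 < r, forall a, `|coef a| * r ^+ (\sum_(j < n) a j)%N <= C &
      \forall y \near p,
        (fun N => \sum_(a : {ffun 'I_n -> 'I_N})
           coef (fun j => a j : nat) * monomial (fun j => a j : nat) (y - p))
          @ \oo --> g y].

Definition analytic_at (R : realType) n (g : 'rV[R]_n -> R) (p : 'rV[R]_n) :=
  \forall q \near p, power_series_at g q.

Definition holomorphic_at (R : realType) n
    (g : 'rV[complexes R]_n -> complexes R) (p : 'rV[complexes R]_n) :=
  \forall q \near p, differentiable g q.

Definition model_reg (R : realType) (c : geometry) (n : nat) :
    ('rV[scalars R c]_n -> scalars R c) -> 'rV[scalars R c]_n -> Prop :=
  match c with
  | Smooth => @smooth_at R n
  | RealAnalytic => @analytic_at R n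
  | Holomorphic => @holomorphic_at R n
  end.

(* [reg] is the structure sheaf, a sheaf of algebras of functions locally
   isomorphic to the model one: [reg f x] means that f is smooth (resp. real
   analytic, holomorphic) on a neighbourhood of x.  Locality and closure under
   the algebra operations also follow from [chartP]. *)
Record manifold (R : realType) (c : geometry) (n : nat) := Manifold {
  point :> topologicalType;
  reg : (point -> scalars R c) -> point -> Prop;
  reg_germ : forall f g x, reg f x -> (\forall y \near x, f y = g y) -> reg g x;
  reg_near : forall f x, reg f x -> \forall y \near x, reg f y;
  reg_cst : forall a x, reg (fun=> a) x;
  reg_add : forall f g x, reg f x -> reg g x -> reg (fun y => f y + g y) x;
  reg_mul : forall f g x, reg f x -> reg g x -> reg (fun y => f y * g y) x;
  manifold_hausdorff : hausdorff_space point;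
  manifold_second_countable : @second_countable point;
  chartP : forall x0 : point,
    exists (U : set point) (phi : point -> 'rV[scalars R c]_n)
           (psi : 'rV[scalars R c]_n -> point),
    [/\ open U /\ U x0, open (phi @` U),
        forall y, U y -> psi (phi y) = y,
        (forall y, U y -> {for y, continuous phi}) /\
        (forall p, (phi @` U) p -> {for p, continuous psi}) &
        forall y f, U y -> reg f y <-> model_reg (f \o psi) (phi y)]
}.

Section Foliations.
Context {R : realType} {c : geometry} {n : nat} (M : manifold R c n).
Local Notation K := (scalars R c).

(* vector fields are the derivations of the structure sheaf *)

Definition vfop := (M -> K) -> M -> K.

Definition vector_field (X : vfop) (x : M) : Prop :=
  \forall y \near x,
  [/\ forall a f g, reg f y -> reg g y ->
        X (fun z => a * f z + g z) y = a * X f y + X g y,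
      forall f g, reg f y -> reg g y ->
        X (fun z => f z * g z) y = X f y * g y + f y * X g y,
      forall f g, reg f y -> reg g y -> (\forall z \near y, f z = g z) ->
        X f y = X g y &
      forall f, reg f y -> reg (X f) y].

Definition vf_eq (X Y : vfop) (x : M) : Prop :=
  \forall y \near x, forall f, reg f y -> X f y = Y f y.

Definition vf_bracket (X Y : vfop) : vfop :=
  fun f y => X (Y f) y - Y (X f) y.

Record hermann_foliation (D : vfop -> M -> Prop) : Prop := HermannFoliation {
  fol_vf : forall X x, D X x -> vector_field X x;
  fol_germ : forall X Y x, D X x -> vf_eq X Y x -> D Y x;
  fol_near : forall X x, D X x -> \forall y \near x, D X y;
  fol_0 : forall x, D (fun _ _ => 0) x;
  fol_lin : forall f X Y x, reg f x -> D X x -> D Y x ->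
    D (fun h y => f y * X h y + Y h y) x;
  fol_fg : forall x : M, exists (r : nat) (X : 'I_r -> vfop), \forall y \near x,
    (forall k, D (X k) y) /\
    forall Y, D Y y -> exists f : 'I_r -> M -> K,
      (forall k, reg (f k) y) /\
      vf_eq Y (fun h z => \sum_(k < r) f k z * X k h z) y;
  fol_bracket : forall X Y x, D X x -> D Y x -> D (vf_bracket X Y) x
}.

(* A vector bundle is given by its fibers and its sheaf of (smooth, real analytic
   or holomorphic) sections, which admits local frames; the rank is locally
   constant. *)

Record vbundle := VBundle {
  fib : M -> vectType K;
  vreg : (forall x, fib x) -> M -> Prop;
  frameP : forall x0 : M, exists (r : nat) (e : forall x, r.-tuple (fib x)),
    \forall x \near x0, basis_of fullv (e x) /\
      forall s, vreg s x <->
        forall k : 'I_r, reg (fun y => coord (e y) k (s y)) x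
}.

(* Functions on a graded vector bundle are sections of S(E^* ).

   An element of S(E_x^* ) is the function sending v_1, ..., v_n, homogeneous
   vectors of E_x, to its iterated contraction (arity 0 component of)
   d_{v_n} ... d_{v_1} xi, where d_v is the derivation given by
   contraction with v; the arity n component is a graded symmetric n-linear
   form on E_x (K has characteristic 0).  Since the E_{-i}^* have positive
   degrees, an element of fixed degree has finitely many components. *)

Section GradedFunctions.
Variable E : nat -> vbundle.

Definition hvec (x : M) := {i : nat & fib (E i) x}.
Definition hv (i : nat) (x : M) (v : fib (E i) x) : hvec x :=
  existT (fun j => fib (E j) x) i v.
(* [hdeg v] is the opposite of the degree of v *)
Definition hdeg (x : M) (v : hvec x) : nat := (tag v).+1.

Definition gfun := forall x : M, seq (hvec x) -> K.

Definition hsec := {i : nat & forall x, fib (E i) x}.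
Definition hsec_at (s : hsec) (x : M) : hvec x := hv (tagged s x).

(* xi is a section, near x, of the degree k component of S(E^* ) *)
Definition gf (k : nat) (xi : gfun) (x : M) : Prop :=
  \forall y \near x,
  [/\ forall (s t : seq (hvec y)) i a (u v : fib (E i) y),
        xi y (s ++ hv (a *: u + v) :: t)
        = a * xi y (s ++ hv u :: t) + xi y (s ++ hv v :: t),
      forall (s t : seq (hvec y)) (u v : hvec y),
        xi y (s ++ u :: v :: t)
        = (-1) ^+ (hdeg u * hdeg v) * xi y (s ++ v :: u :: t),
      forall s : seq (hvec y), (\sum_(v <- s) hdeg v)%N != k -> xi y s = 0 &
      forall m (s : 'I_m -> hsec), (forall l, vreg (tagged (s l)) y) ->
        reg (fun z => xi z [seq hsec_at (s l) z | l <- enum 'I_m]) y].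

Definition gf_eq_at (xi eta : gfun) (x : M) : Prop :=
  forall s, xi x s = eta x s.

Definition gf_of_fun (f : M -> K) : gfun :=
  fun x s => if s is [::] then f x else 0.

(* sections of the dual of E_{-(i+1)}: functions of degree i+1 and arity 1 *)
Definition covector (i : nat) (al : gfun) (x : M) : Prop :=
  gf i.+1 al x /\ \forall y \near x, forall s, size s != 1%N -> al y s = 0.

Definition pairing (al : gfun) (x : M) (i : nat) (v : fib (E i) x) : K :=
  al x [:: hv v].

Definition gf_lin (f : M -> K) (xi eta : gfun) : gfun :=
  fun x s => f x * xi x s + eta x s.

(* Product of xi, of degree p, with eta, in terms of iterated contractions:
   d_v (xi eta) = (d_v xi) eta + (-1)^{|v| p} xi (d_v eta), |d_v xi| = p - |v|;
   only the parity of p matters. *)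
Fixpoint fmul (x : M) (p : nat) (xi eta : seq (hvec x) -> K)
    (s : seq (hvec x)) : K :=
  match s with
  | [::] => xi [::] * eta [::]
  | v :: s' =>
      fmul (p + hdeg v)%N (fun t => xi (v :: t)) eta s' +
      (-1) ^+ (p * hdeg v) * fmul p xi (fun t => eta (v :: t)) s'
  end.
Definition gmul (p : nat) (xi eta : gfun) : gfun :=
  fun x => fmul p (xi x) (eta x).

Definition contract (v : hsec) (xi : gfun) : gfun :=
  fun x s => xi x (hsec_at v x :: s).
Arguments contract v xi x s : clear implicits.

(* the graded commutator [D, d_v], for an operator D of degree p *)
Definition comm_contract (p : nat) (D : gfun -> gfun) (v : hsec) (xi : gfun) :
    gfun :=
  fun x s => D (contract v xi) x s
    - (-1) ^+ (p * (tag v).+1) * contract v (D xi) x s.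

End GradedFunctions.

Arguments gf_of_fun E f x s : clear implicits.
Arguments gf_lin {E} f xi eta x s.
Arguments gmul {E} p xi eta x s.
Arguments contract {E} v xi x s.
Arguments comm_contract {E} p D v xi x s.

(* [lin i] is the linear part d^(i+2) : E_{-(i+2)} -> E_{-(i+1)}; it is uniquely
   determined by Q through [linP].  The identities below are imposed at every x
   near which the arguments are sections, hence near x. *)

Record lie_infty_algebroid := LieInftyAlgebroid {
  bun :> nat -> vbundle;
  Q : gfun bun -> gfun bun;
  Q_germ : forall k xi eta x, gf k xi x -> gf k eta x ->
    (\forall y \near x, gf_eq_at xi eta y) -> gf_eq_at (Q xi) (Q eta) x;
  Q_deg : forall k xi x, gf k xi x -> gf k.+1 (Q xi) x;
  Q_lin : forall k (a : K) xi eta x, gf k xi x -> gf k eta x ->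
    gf_eq_at (Q (gf_lin (fun=> a) xi eta)) (gf_lin (fun=> a) (Q xi) (Q eta)) x;
  Q_der : forall p q xi eta x, gf p xi x -> gf q eta x ->
    gf_eq_at (Q (gmul p xi eta))
      (gf_lin (fun=> (-1) ^+ p) (gmul p xi (Q eta)) (gmul p.+1 (Q xi) eta)) x;
  Q_sq : forall k xi x, gf k xi x ->
    gf_eq_at (Q (Q xi)) (gf_of_fun bun (fun=> 0)) x;
  lin : forall i x, {linear fib (bun i.+1) x -> fib (bun i) x};
  linP : forall i al x, covector i al x -> forall v : fib (bun i.+1) x,
    pairing (Q al) v = (-1) ^+ i.+1 * pairing al (lin i x v)
}.

Arguments Q : clear implicits.

Section Holonomy.
Variable E : lie_infty_algebroid.

Definition anchor_at (x : M) (v : fib (E 0) x) (f : M -> K) : K :=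
  pairing (Q E (gf_of_fun E f)) v.

Definition anchor (s : forall x, fib (E 0) x) : vfop :=
  fun f y => anchor_at (s y) f.

(* The binary derived bracket, with values in E_{-(i+j+1)}: the vector w such
   that [[Q, d_s], d_t] has fiberwise constant component d_w, at y. *)
Definition bracket (i j : nat) (s : forall x, fib (E i) x)
    (t : forall x, fib (E j) x) (y : M) : fib (E (i + j)%N) y :=
  let s' : hsec E := existT _ i s in
  let t' : hsec E := existT _ j t in
  xget 0 [set w : fib (E (i + j)%N) y | forall al, covector (i + j)%N al y ->
    comm_contract (1 + i.+1)%N (comm_contract 1 (Q E) s') t' al y [::]
    = pairing al w].

Definition universal_resolving (D : vfop -> M -> Prop) : Prop :=
  [/\ forall X x, D X x <-> exists2 s, vreg s x & vf_eq (anchor s) X x,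
      forall s x, vreg s x ->
        (vf_eq (anchor s) (fun _ _ => 0) x <->
         exists2 t, vreg t x & \forall y \near x, lin E 0 y (t y) = s y) &
      forall i (s : forall x, fib (E i.+1) x) x, vreg s x ->
        ((\forall y \near x, lin E i y (s y) = 0) <->
         exists2 t, vreg t x & \forall y \near x, lin E i.+1 y (t y) = s y)].

(* anchor_at v is the point derivation rho_x(v) *)
Definition cocycle (x : M) (i : nat) : {pred fib (E i) x} :=
  match i return {pred fib (E i) x} with
  | 0 => [pred v | `[< forall f, reg f x -> anchor_at v f = 0 >]]
  | j.+1 => [pred v | lin E j x v == 0]
  end.

Definition coboundary (x : M) (i : nat) : {pred fib (E i) x} :=
  [pred v | `[< exists t, v = lin E i x t >]].

Arguments cocycle x i v : clear implicits.
Arguments coboundary x i v : clear implicits.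

Lemma gf_of_fun_gf f x : reg f x -> gf 0 (gf_of_fun E f) x.
Proof.
move=> /reg_near fx; near=> y; split.
- by move=> [|? ?] t i a u v /=; rewrite mulr0 addr0.
- by move=> [|? ?] t u v /=; rewrite mulr0.
- by case=> [|v s]; rewrite ?big_nil.
- move=> [|m] s _.
    rewrite (_ : (fun z => _) = f); first by near: y.
    by apply/funext=> z; rewrite (size0nil (size_enum_ord 0)).
  rewrite (_ : (fun z => _) = fun=> 0); first exact: reg_cst.
  by apply/funext=> z; rewrite enum_ordSl.
Unshelve. all: by end_near. Qed.

Fact anchor_at_linear x f : reg f x -> linear_for *%R (fun v => @anchor_at x v f).
Proof.
move=> /gf_of_fun_gf/Q_deg/nbhs_singleton[lin1 _ _ _] a u v.
exact: (lin1 [::] [::]).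
Qed.

Fact cocycle_closed x i : submod_closed (cocycle x i).
Proof.
split=> [|a u v].
- case: i => [|i]; rewrite inE; last by rewrite linear0.
  move=> f /anchor_at_linear L.
  by have := L (-1) 0 0; rewrite scaler0 addr0 mulN1r addNr.
- case: i u v => [|i] u v; rewrite !inE.
    move=> hu hv f fx.
    by rewrite (anchor_at_linear fx) hu// hv// mulr0 addr0.
  by rewrite linearP => /eqP-> /eqP->; rewrite scaler0 addr0.
Qed.
HB.instance Definition _ x i := GRing.isSubmodClosed.Build K (fib (E i) x)
  (cocycle x i) (cocycle_closed x i).

Fact coboundary_closed x i : submod_closed (coboundary x i).
Proof.
split=> [|a u v]; rewrite !inE; first by exists 0; rewrite linear0.
move=> [s ->] [t ->].
by exists (a *: s + t); rewrite linearP.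
Qed.
HB.instance Definition _ x i := GRing.isSubmodClosed.Build K (fib (E i) x)
  (coboundary x i) (coboundary_closed x i).

(* coboundaries are cocycles because Q^2 = 0 *)
Definition hol (x : M) (i : nat) : lmodType K :=
  subquot (cocycle x i) (coboundary x i).

(* The class of the bracket, at x, of sections extending representatives; it does
   not depend on the representatives and extensions. *)
Definition hol_bracket (x : M) (i j : nat) (a : hol x i) (b : hol x j) :
    hol x (i + j)%N :=
  xget 0 [set d | exists (s : forall y, fib (E i) y) (t : forall y, fib (E j) y)
      (u : subspace (cocycle x i)) (v : subspace (cocycle x j))
      (w : subspace (cocycle x (i + j)%N)),
    [/\ vreg s x /\ vreg t x, val u = s x /\ val v = t x,
        val w = bracket s t x, a = cls _ u /\ b = cls _ v & d = cls _ w]].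
End Holonomy.

Arguments cocycle E x i v : clear implicits.
Arguments coboundary E x i v : clear implicits.

(* Morphisms over the identity of an open set U from the restriction of E to that
   of F are morphisms Gamma(S(F^* )) -> Gamma(S(E^* )); U = setT gives those over
   the identity of M. *)

Record morphism_on (U : set M) (E F : lie_infty_algebroid)
    (Phi : gfun F -> gfun E) : Prop := MorphismOn {
  mor_germ : forall k xi eta x, U x -> gf k xi x -> gf k eta x ->
    (\forall y \near x, gf_eq_at xi eta y) -> gf_eq_at (Phi xi) (Phi eta) x;
  mor_deg : forall k xi x, U x -> gf k xi x -> gf k (Phi xi) x;
  mor_lin : forall k f xi eta x, U x -> reg f x -> gf k xi x -> gf k eta x ->
    gf_eq_at (Phi (gf_lin f xi eta)) (gf_lin f (Phi xi) (Phi eta)) x;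
  mor_one : forall x, U x ->
    gf_eq_at (Phi (gf_of_fun F (fun=> 1))) (gf_of_fun E (fun=> 1)) x;
  mor_mul : forall p q xi eta x, U x -> gf p xi x -> gf q eta x ->
    gf_eq_at (Phi (gmul p xi eta)) (gmul p (Phi xi) (Phi eta)) x;
  mor_Q : forall k xi x, U x -> gf k xi x ->
    gf_eq_at (Q E (Phi xi)) (Phi (Q F xi)) x
}.

(* w is the image of v under the linear part of Phi *)
Definition linear_part (E F : lie_infty_algebroid) (Phi : gfun F -> gfun E)
    (x : M) (i : nat) (v : fib (E i) x) (w : fib (F i) x) : Prop :=
  forall al, covector i al x -> pairing (Phi al) v = pairing al w.

Definition induced_by (E F : lie_infty_algebroid) (Phi : gfun F -> gfun E)
    (x : M) (phi : forall i, hol E x i -> hol F x i) : Prop :=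
  forall i (u : subspace (cocycle E x i)),
    exists2 w : subspace (cocycle F x i),
      linear_part Phi (val u) (val w) & phi i (cls _ u) = cls _ w.

End Foliations.

Arguments morphism_on {R c n M} U E F Phi.
Arguments induced_by {R c n M} E F Phi x phi.

(* Main.v *)
(* Near x, the linear parts of E and F are free resolutions of the germs of D by
   modules of sections, so there is a chain map f from E to F over D, and it is
   unique up to homotopy.  Evaluated at x, homotopic chain maps agree on
   cohomology, which gives mutually inverse linear isomorphisms; the linear part
   of a morphism is a chain map, hence induces the same isomorphism.
   For the bracket, let T = f^* Q_F - Q_E f^*.  As f is a chain map, T xi has
   arity at least 2, and its arity 2 part is xi (B(u, v)) for a bilinear map B
   which, on cocycles at x, is up to sign f{u, v} - {f u, f v}.  The identity
   T Q_F = - Q_E T makes B a chain map from the tensor square of E to F; by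
   freeness of E and exactness of F it is null-homotopic, so that B(u, v) is a
   coboundary when u and v are cocycles at x.
   No Lie infinity-morphism from E to F needs to be constructed. *)

Require Import Defs.
From HB Require Import structures.
From mathcomp Require Import all_boot all_order all_algebra.
From mathcomp Require Import all_classical all_reals all_analysis.
From mathcomp Require Import ring zify.
Import Order.TTheory GRing.Theory Num.Theory.
Local Open Scope classical_set_scope.
Local Open Scope ring_scope.

Set Implicit Arguments.
Unset Strict Implicit.
Unset Printing Implicit Defensive.

Arguments gf_of_fun {R c n M} E f x s.
Arguments gf_lin {R c n M E} f xi eta x s.
Arguments gmul {R c n M E} p xi eta x s.
(* mathcomp-analysis shadows these two names *)
Local Notation contract := Defs.contract.
Local Notation subspace := Defs.subspace.
Arguments Defs.contract {R c n M E} v xi x s.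
Arguments comm_contract {R c n M E} p D v xi x s.
Arguments Q {R c n M} l xi x s.
Arguments cocycle {R c n M} E x i v.
Arguments coboundary {R c n M} E x i v.
Arguments anchor_at {R c n M} E x v f.

(** [Q] is known only as a local operator obeying the Leibniz rule, with no coordinate formula. Its
    components of arity 1 and 2 are extracted by an induction on products: near x, a graded function
    without constant term is a finite sum of coframe elements times functions of lower degree, so an
    additive identity need only be checked on such products. The binary bracket is not O-bilinear:
    it carries derivatives along the anchor. These terms disappear at x on vectors with null anchor,
    and everywhere near x in the defect T, because f commutes with the anchors. The arity 2 part of
    T is therefore a bundle map, and bundle maps can be lifted through the resolution by choosing
    values on a frame. E may have infinitely many E_{-i}, and the neighbourhoods on which choices
    are valid may shrink with i. A function of degree k only sees the indices i < k, so each
    identity is proved in bounded degree, where finitely many neighbourhoods are intersected. *)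

Section RegularFunctions.
Context {R : realType} {c : geometry} {n : nat} {M : manifold R c n}.
Local Notation K := (scalars R c).
Implicit Types (x y : M) (f g : M -> K).

Lemma reg_lin f g h x : reg f x -> reg g x -> reg h x ->
  reg (fun y => f y * g y + h y) x.
Proof. by move=> rf rg rh; apply: reg_add rh; apply: reg_mul. Qed.

Lemma near_near_and (P : M -> Prop) x : (\forall y \near x, P y) ->
  \forall y \near x, P y /\ \forall z \near y, P z.
Proof. by move=> nP; apply: filterI => //; exact: near_join. Qed.

End RegularFunctions.

(** * Local frames of vector bundles and regularity of sections *)

Section Frames.
Context {R : realType} {c : geometry} {n : nat} {M : manifold R c n}.
Local Notation K := (scalars R c).
Implicit Types (x y : M).

(** A frame reduced to identities at a single point, so that it can be combined with other
    conditions under [near]. *)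
Record frame_at (V : vbundle M) r (e : 'I_r -> forall y, fib V y)
    (co : 'I_r -> forall y, fib V y -> K) (y : M) : Prop := FrameAt {
  frame_lin : forall k a u v, co k y (a *: u + v) = a * co k y u + co k y v;
  frame_id : forall v, v = \sum_k co k y v *: e k y;
  frame_reg : forall s, vreg s y <-> forall k, reg (fun z => co k z (s z)) y;
  frame_sec : forall k, vreg (e k) y;
  frame_dual : forall k l, co k y (e l y) = (l == k)%:R
}.

Lemma local_frame (V : vbundle M) x : exists r (e : 'I_r -> forall y, fib V y)
  (co : 'I_r -> forall y, fib V y -> K), \forall y \near x, frame_at e co y.
Proof.
have [r [e eP]] := frameP V x.
exists r, (fun k y => (e y)`_k), (fun k y => coord (e y) k).
apply: filterS (near_near_and eP) => y [[eb er] ne]; split => //.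
- by move=> k a u v; rewrite linearP.
- by move=> v; apply: coord_basis eb _; rewrite memvf.
- move=> k; apply/er => l.
  apply: (@reg_germ _ _ _ _ (fun=> (k == l)%:R)); first exact: reg_cst.
  by apply: filterS ne => z [ze _]; rewrite coord_free ?(basis_free ze).
- by move=> k l; rewrite coord_free ?(basis_free eb).
Qed.

Lemma frame_coord V r (e : 'I_r -> forall y, fib V y) co y (a : 'I_r -> K) k :
  frame_at e co y -> co k y (\sum_l a l *: e l y) = a k.
Proof.
move=> fy; have co0 : co k y 0 = 0.
  by have := frame_lin fy k (-1) 0 0; rewrite scaler0 addr0 mulN1r addNr.
have -> : co k y (\sum_l a l *: e l y) = \sum_l a l * co k y (e l y).
  elim: (index_enum _) => [|l s IH]; first by rewrite !big_nil.
  by rewrite !big_cons (frame_lin fy) IH.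
rewrite (bigD1 k)//= (frame_dual fy) eqxx mulr1 big1 ?addr0// => l lk.
by rewrite (frame_dual fy) (negbTE lk) mulr0.
Qed.

Lemma vreg_near (V : vbundle M) (s : forall y, fib V y) x : vreg s x ->
  \forall y \near x, vreg s y.
Proof.
have [r [e [co nf]]] := local_frame V x.
have fx := nbhs_singleton nf.
move=> /(frame_reg fx) sx.
have: \forall y \near x, forall k, reg (fun z => co k z (s z)) y.
  apply: filter_forall => k; exact: reg_near.
by apply: filterS2 nf => y fy /(frame_reg fy).
Qed.

Lemma vreg_germ (V : vbundle M) (s t : forall y, fib V y) x : vreg s x ->
  (\forall y \near x, s y = t y) -> vreg t x.
Proof.
have [r [e [co /nbhs_singleton fx]]] := local_frame V x.
move=> /(frame_reg fx) sx st; apply/(frame_reg fx) => k.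
by apply: reg_germ (sx k) _; apply: filterS st => y ->.
Qed.

Lemma vreg_lin (V : vbundle M) f (s t : forall y, fib V y) x : reg f x ->
  vreg s x ->
  vreg t x -> vreg (fun y => f y *: s y + t y) x.
Proof.
have [r [e [co nf]]] := local_frame V x; have fx := nbhs_singleton nf.
move=> rf /(frame_reg fx) sx /(frame_reg fx) tx; apply/(frame_reg fx) => k.
apply: (reg_germ (reg_lin rf (sx k) (tx k))).
by apply: filterS nf => y fy; rewrite (frame_lin fy).
Qed.

Lemma vreg0 (V : vbundle M) x : vreg (fun y => 0 : fib V y) x.
Proof.
have [r [e [co nf]]] := local_frame V x; have fx := nbhs_singleton nf.
apply/(frame_reg fx) => k; apply: (@reg_germ _ _ _ _ (fun=> 0)).
  exact: reg_cst.
apply: filterS nf => y fy.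
by have := frame_lin fy k (-1) 0 0; rewrite scaler0 addr0 mulN1r addNr => ->.
Qed.

Lemma vreg_sum (V : vbundle M) (I : Type) (r : seq I) (f : I -> M -> K)
    (s : I -> forall y, fib V y) x :
  (forall i, reg (f i) x) -> (forall i, vreg (s i) x) ->
  vreg (fun y => \sum_(i <- r) f i y *: s i y) x.
Proof.
move=> rf rs; elim: r => [|i r IH].
  by apply: vreg_germ (vreg0 V x) _; apply: nearW => y; rewrite big_nil.
apply: vreg_germ (vreg_lin (rf i) (rs i) IH) _.
by apply: nearW => y; rewrite big_cons.
Qed.

Lemma section_through (V : vbundle M) x (v : fib V x) :
  exists2 s, vreg s x & s x = v.
Proof.
have [r [e [co nf]]] := local_frame V x; have fx := nbhs_singleton nf.
exists (fun y => \sum_k co k x v *: e k y); last by rewrite -(frame_id fx).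
apply: vreg_sum => k; first exact: reg_cst.
exact: frame_sec fx k.
Qed.

End Frames.

(** * Pointwise graded symmetric forms *)

Section PointwiseForms.
Context {R : realType} {c : geometry} {n : nat} {M : manifold R c n}.
Local Notation K := (scalars R c).
Variables (E : nat -> vbundle M) (y : M).
Local Notation form := (seq (hvec E y) -> K).
Implicit Types (X Y : form) (l s t : seq (hvec E y)).

(** The algebraic conditions of [gf] on a single fiber, where forms can be handled by induction on
    lists. *)
Definition multilinear_form X := forall s t i a (u v : fib (E i) y),
  X (s ++ hv (a *: u + v) :: t) = a * X (s ++ hv u :: t) + X (s ++ hv v :: t).
Definition graded_symmetric X := forall s t (u v : hvec E y),
  X (s ++ u :: v :: t) = (-1) ^+ (hdeg u * hdeg v) * X (s ++ v :: u :: t).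
Definition form_degree k X :=
  forall s, (\sum_(v <- s) hdeg v)%N != k -> X s = 0.

Lemma multilinear_formZ X s t i a (u : fib (E i) y) : multilinear_form X ->
  X (s ++ hv (a *: u) :: t) = a * X (s ++ hv u :: t).
Proof.
move=> mX; have := mX s t i (-1) 0 0.
rewrite scaler0 addr0 mulN1r addNr => X0.
by have := mX s t i a u 0; rewrite addr0 X0 addr0.
Qed.

Lemma multilinear_form0 X s t i : multilinear_form X ->
  X (s ++ hv (0 : fib (E i) y) :: t) = 0.
Proof.
move=> mX; have := multilinear_formZ s t 0 (0 : fib (E i) y) mX.
by rewrite scale0r mul0r.
Qed.

Lemma multilinear_form_sum X s t i (I : Type) (r : seq I) (a : I -> K)
    (u : I -> fib (E i) y) : multilinear_form X ->
  X (s ++ hv (\sum_(k <- r) a k *: u k) :: t)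
  = \sum_(k <- r) a k * X (s ++ hv (u k) :: t).
Proof.
move=> mX; elim: r => [|k r IH]; first by rewrite !big_nil multilinear_form0.
by rewrite !big_cons mX IH.
Qed.

Lemma fmul_linl p a X X' Y l :
  fmul p (fun s => a * X s + X' s) Y l = a * fmul p X Y l + fmul p X' Y l.
Proof.
elim: l p X X' Y => [|v l IH] p X X' Y /=; first by rewrite mulrDl mulrA.
by rewrite !IH; ring.
Qed.

Lemma fmul_linr p a X Y Y' l :
  fmul p X (fun s => a * Y s + Y' s) l = a * fmul p X Y l + fmul p X Y' l.
Proof.
elim: l p X Y Y' => [|v l IH] p X Y Y' /=; first by rewrite mulrDr; ring.
by rewrite !IH; ring.
Qed.

Lemma fmul0l p Y l : fmul p (fun=> 0) Y l = 0.
Proof.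
by elim: l p Y => [|v l IH] p Y /=; rewrite ?mul0r// !IH mulr0 addr0.
Qed.

Lemma fmul0r p X l : fmul p X (fun=> 0) l = 0.
Proof.
by elim: l p X => [|v l IH] p X /=; rewrite ?mulr0// !IH mulr0 addr0.
Qed.

Lemma fmulZl p a X Y l : fmul p (fun s => a * X s) Y l = a * fmul p X Y l.
Proof.
have := fmul_linl p a X (fun=> 0) Y l; rewrite fmul0l addr0 => <-.
by congr fmul; apply/funext => s; rewrite addr0.
Qed.

Lemma fmulZr p a X Y l : fmul p X (fun s => a * Y s) l = a * fmul p X Y l.
Proof.
have := fmul_linr p a X Y (fun=> 0) l; rewrite fmul0r addr0 => <-.
by congr fmul; apply/funext => s; rewrite addr0.
Qed.

Lemma fmul_arity0l p X Y l : ~~ odd p -> (forall v s, X (v :: s) = 0) ->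
  fmul p X Y l = X [::] * Y l.
Proof.
move=> p0; elim: l X Y => [|v l IH] X Y X0 //=.
rewrite (_ : (fun t => X (v :: t)) = fun=> 0); last by apply/funext.
by rewrite fmul0l add0r IH// -signr_odd oddM (negbTE p0) mul1r.
Qed.

Lemma fmul_multilinear p X Y : multilinear_form X -> multilinear_form Y ->
  multilinear_form (fmul p X Y).
Proof.
move=> mX mY s t i a u v.
elim: s p X Y mX mY => [|w s IH] p X Y mX mY /=.
  rewrite (_ : (fun l => X (hv (a *: u + v) :: l)) =
      fun l => a * X (hv u :: l) + X (hv v :: l)); last first.
    by apply/funext => l; apply: (mX [::]).
  rewrite (_ : (fun l => Y (hv (a *: u + v) :: l)) =
      fun l => a * Y (hv u :: l) + Y (hv v :: l)); last first.
    by apply/funext => l; apply: (mY [::]).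
  by rewrite fmul_linl fmul_linr {1 3}/hdeg /=; ring.
have mX' : multilinear_form (fun l => X (w :: l)).
  by move=> s' t' i' a' u' v'; apply: (mX (w :: s')).
have mY' : multilinear_form (fun l => Y (w :: l)).
  by move=> s' t' i' a' u' v'; apply: (mY (w :: s')).
by rewrite (IH _ _ _ mX' mY) (IH _ _ _ mX mY'); ring.
Qed.

Lemma fmul_symmetric p X Y : graded_symmetric X -> graded_symmetric Y ->
  graded_symmetric (fmul p X Y).
Proof.
move=> sX sY s t u v; elim: s p X Y sX sY => [|w s IH] p X Y sX sY.
  rewrite /= (_ : (fun l => X (u :: v :: l)) =
    fun l => (-1) ^+ (hdeg u * hdeg v) * X (v :: u :: l)); last first.
    by apply/funext => l; apply: (sX [::]).
  rewrite (_ : (fun l => Y (u :: v :: l)) =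
    fun l => (-1) ^+ (hdeg u * hdeg v) * Y (v :: u :: l)); last first.
    by apply/funext => l; apply: (sY [::]).
  rewrite fmulZl fmulZr !mulnDl !exprD (addnAC p).
  have signK (k : nat) : (-1 : K) ^+ k * (-1) ^+ k = 1.
    by rewrite -exprD addnn -mul2n exprM sqrrN !expr1n.
  rewrite [(hdeg v * hdeg u)%N]mulnC.
  set e := (-1) ^+ (_ * _); have ee : e * e = 1 by apply: signK.
  set e1 := (-1) ^+ (p * _); set e2 := (-1) ^+ (p * _).
  set F := fmul _ _ _ _; set F1 := fmul _ _ _ _; set F2 := fmul _ _ _ _.
  set F3 := fmul _ _ _ _.
  (* One mixed term carries no exchange sign e; writing it with e * e = 1 lets e factor out of all
     four terms. *)
  transitivity (e * F + e1 * e * F1 + e2 * ((e * e) * F2) + e2 * e1 * e * F3).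
    by rewrite ee; ring.
  by ring.
have sX' : graded_symmetric (fun l => X (w :: l)).
  by move=> s' t' u' v'; apply: (sX (w :: s')).
have sY' : graded_symmetric (fun l => Y (w :: l)).
  by move=> s' t' u' v'; apply: (sY (w :: s')).
by rewrite !cat_cons /= (IH _ _ _ sX' sY) (IH _ _ _ sX sY'); ring.
Qed.

(* [da] and [db] are the degrees already consumed by contractions; stating the
   conditions additively avoids truncated subtraction *)
Lemma fmul_degree_rec p X Y a b da db l :
  (forall s, (\sum_(v <- s) hdeg v + da)%N != a -> X s = 0) ->
  (forall s, (\sum_(v <- s) hdeg v + db)%N != b -> Y s = 0) ->
  (\sum_(v <- l) hdeg v + (da + db))%N != (a + b)%N -> fmul p X Y l = 0.
Proof.
elim: l p X Y da db => [|w l IH] p X Y da db dX dY.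
  rewrite big_nil add0n => dab.
  have [e|na] := eqVneq da a; last by rewrite /= dX ?big_nil// mul0r.
  rewrite /= dY ?mulr0// big_nil add0n; apply: contraNneq dab => ->.
  by rewrite e.
rewrite big_cons => dl /=.
rewrite (IH _ _ _ (hdeg w + da)%N db) ?(IH _ _ _ da (hdeg w + db)%N);
  first by rewrite mulr0 addr0.
- exact: dX.
- by move=> s ds; apply: dY; rewrite big_cons; lia.
- lia.
- by move=> s ds; apply: dX; rewrite big_cons; lia.
- exact: dY.
- lia.
Qed.

Lemma fmul_degree p X Y a b : form_degree a X -> form_degree b Y ->
  form_degree (a + b) (fmul p X Y).
Proof.
move=> dX dY l dl; apply: (@fmul_degree_rec _ _ _ a b 0 0); rewrite ?addn0//.
- by move=> s; rewrite addn0 => /dX.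
- by move=> s; rewrite addn0 => /dY.
Qed.

Lemma form_degree0 k X : form_degree k X -> k != 0%N -> X [::] = 0.
Proof. by move=> dX k0; apply: dX; rewrite big_nil eq_sym. Qed.

Lemma form_degree1 k X i (u : fib (E i) y) : form_degree k X -> k != i.+1 ->
  X [:: hv u] = 0.
Proof. by move=> dX ki; apply: dX; rewrite big_seq1 eq_sym. Qed.

(** [untag] returns its default 0 on a vector of any other degree. *)
Definition dual_form i (co : fib (E i) y -> K) : form :=
  fun l => if l is [:: h] then untag 0 co h else 0.

Arguments dual_form : simpl never.

Lemma dual_form1 i (co : fib (E i) y -> K) u : dual_form co [:: hv u] = co u.
Proof.
by rewrite /dual_form (@untagE _ _ _ _ _ co (hv u) (erefl i)).
Qed.

Lemma dual_form_neq i (co : fib (E i) y -> K) j (u : fib (E j) y) :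
  j != i -> dual_form co [:: hv u] = 0.
Proof. by move=> ji; rewrite /dual_form untag_dflt. Qed.

End PointwiseForms.
Arguments dual_form : simpl never.

(** * Euler decomposition of graded functions *)

Section Euler.
Context {R : realType} {c : geometry} {n : nat} {M : manifold R c n}.
Local Notation K := (scalars R c).
Variables (E : nat -> vbundle M) (y : M).
Local Notation form := (seq (hvec E y) -> K).
Implicit Types (X Y : form) (l s t : seq (hvec E y)).

Definition arity1 X := forall s, size s != 1%N -> X s = 0.

Lemma fmul_covector_nil q X Y : arity1 X -> fmul q X Y [::] = 0.
Proof. by move=> aX /=; rewrite aX// mul0r. Qed.

(** Contracting X with v leaves a constant, zero unless v has degree q. In that case q + hdeg v is
    even and the product with the constant is a plain scalar multiple. *)
Lemma fmul_covector_cons q X Y v l : arity1 X -> form_degree q X ->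
  fmul q X Y (v :: l)
  = X [:: v] * Y l + (-1) ^+ (q * hdeg v) * fmul q X (fun t => Y (v :: t)) l.
Proof.
move=> aX dX /=; congr (_ + _).
have [vq|vq] := eqVneq (hdeg v) q.
  by rewrite fmul_arity0l ?vq ?addnn ?odd_double// => w s; apply: aX.
rewrite (_ : (fun t => X (v :: t)) = fun=> 0).
  by rewrite fmul0l dX ?mul0r// big_seq1.
apply/funext => -[|w s]; last exact: aX.
by apply: dX; rewrite big_seq1.
Qed.

Lemma dual_form_arity1 i (co : fib (E i) y -> K) : arity1 (dual_form co).
Proof. by move=> [|h [|h' s]]. Qed.

Lemma dual_form_degree i (co : fib (E i) y -> K) :
  form_degree i.+1 (dual_form co).
Proof.
move=> [|[j u] [|h' s]]//; rewrite big_seq1 /hdeg /= eqSS => ij.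
exact: dual_form_neq.
Qed.

Section EulerSum.
Variables (p : nat) (r : nat -> nat) (e : forall i, 'I_(r i) -> fib (E i) y).
Variable (co : forall i, 'I_(r i) -> fib (E i) y -> K).
Hypothesis expand : forall i, (i < p)%N ->
  forall v, v = \sum_k co k v *: e k :> fib (E i) y.

(** Only indices below p carry a frame, hence the condition on X from p on; a form of degree at most
    p satisfies it for degree reasons. *)
Lemma dual_frame_sum X h l : multilinear_form X ->
  ((p <= tag h)%N -> X (h :: l) = 0) ->
  \sum_(i < p) \sum_(k < r i) dual_form (co k) [:: h] * X (hv (e k) :: l)
  = X (h :: l).
Proof.
case: h => j v mX; rewrite -[existT _ j v]/(hv v) /= => X0; have [jp|pj] :=
  ltnP j p; last first.
  rewrite X0// big1// => i _; rewrite big1// => k _.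
  by rewrite dual_form_neq ?mul0r// neq_ltn (leq_trans _ pj)// orbT.
rewrite (bigD1 (Ordinal jp))//= [X in _ + X]big1 ?addr0 => [|i ij].
  rewrite [in RHS](expand jp v).
  rewrite (multilinear_form_sum [::] _ _ _ _ mX).
  by apply: eq_bigr => k _; rewrite dual_form1.
rewrite big1// => k _; rewrite dual_form_neq ?mul0r//.
by apply: contraNneq ij => ji; apply/eqP/val_inj.
Qed.

(* contraction with e_k followed by multiplication by eps^k, summed over a
   frame, is the Euler operator *)
Lemma euler_sum X l : multilinear_form X -> graded_symmetric X ->
  (forall s, has (fun h => p <= tag h)%N s -> X s = 0) ->
  \sum_(i < p) \sum_(k < r i)
    fmul i.+1 (dual_form (co k)) (fun t => X (hv (e k) :: t)) l
  = (size l)%:R * X l.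
Proof.
elim: l X => [|h l IH] X mX sX X0.
  rewrite mul0r big1// => i _; rewrite big1// => k _.
  by rewrite fmul_covector_nil//; apply: dual_form_arity1.
under eq_bigr => i _.
  under eq_bigr => k _.
    rewrite fmul_covector_cons; [|exact: dual_form_arity1
      |exact: dual_form_degree].
    (* Exchanging h with the frame vector gives the same sign as moving h past the coframe element.
       The two cancel and leave the Euler sum of X contracted with h. *)
    rewrite (_ : (fun t => X (hv (e k) :: h :: t)) =
      fun t => (-1) ^+ (i.+1 * hdeg h) * X (h :: hv (e k) :: t)); last first.
      by apply/funext => t; apply: (sX [::]).
    rewrite fmulZr mulrA -exprD addnn -mul2n exprM sqrrN !expr1n mul1r.
  over.
  rewrite big_split /=.
over.
rewrite big_split /= dual_frame_sum//; last first.
  by move=> ph; apply: X0; rewrite /= ph.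
rewrite (IH (fun t => X (h :: t))).
- by rewrite -natr1 mulrDl mul1r addrC.
- by move=> s t; apply: (mX (h :: s)).
- by move=> s t; apply: (sX (h :: s)).
- by move=> s hs; apply: X0; rewrite /= hs orbT.
Qed.

End EulerSum.
End Euler.

Section GradedFunctionSheaf.
Context {R : realType} {c : geometry} {n : nat} {M : manifold R c n}.
Local Notation K := (scalars R c).
Variables (E : nat -> vbundle M).
Implicit Types (x y : M) (xi eta : gfun E) (L : seq (hsec E)).

Definition all_vreg L y := foldr (fun s P => vreg (tagged s) y /\ P) True L.

(** Lists replace the families indexed by ['I_m] of [gf], so that the recursion of [fmul] can be
    followed. *)
Definition gf_regular xi y := forall L, all_vreg L y ->
  reg (fun z => xi z [seq hsec_at s z | s <- L]) y.

Lemma gf_regularP xi y : gf_regular xi y <->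
  forall m (s : 'I_m -> hsec E), (forall l, vreg (tagged (s l)) y) ->
    reg (fun z => xi z [seq hsec_at (s l) z | l <- enum 'I_m]) y.
Proof.
split=> [xiy m s sy|xiy L Ly].
  rewrite (_ : (fun z => _) = fun z =>
      xi z [seq hsec_at t z | t <- [seq s l | l <- enum 'I_m]]).
    by apply: xiy; elim: (enum _) => //= l r IH; split.
  by apply/funext => z; rewrite -map_comp.
have := xiy (size L) (tnth (in_tuple L)).
have mapE z : [seq hsec_at (tnth (in_tuple L) l) z | l <- enum 'I_(size L)]
    = [seq hsec_at s z | s <- L].
  rewrite (map_comp (fun s => hsec_at s z) (tnth (in_tuple L))).
  by rewrite (map_tnth_enum (in_tuple L)).
move=> /(_ _)/reg_germ; apply; last by apply: nearW => z; rewrite mapE.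
move=> l; have s0 := tnth (in_tuple L) l; rewrite (tnth_nth s0) /=.
case: l => l /= lL {xiy mapE}; elim: L l Ly lL =>
  [|t L IH] [|l]//= [ty Ly] lL//.
exact: IH.
Qed.

Lemma gfP k xi x : gf k xi x <-> \forall y \near x,
  [/\ multilinear_form (xi y), graded_symmetric (xi y), form_degree k (xi y)
    & gf_regular xi y].
Proof.
by split; apply: filterS => y [? ? ? ?]; split=> //; apply/gf_regularP.
Qed.

End GradedFunctionSheaf.

(** * Operations on graded functions and induction on products *)

Section GradedFunctionOperations.
Context {R : realType} {c : geometry} {n : nat} {M : manifold R c n}.
Local Notation K := (scalars R c).
Variables (E : nat -> vbundle M).
Implicit Types (x y : M) (xi eta al : gfun E) (L : seq (hsec E)).

Lemma gf_near k xi x : gf k xi x -> \forall y \near x, gf k xi y.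
Proof. exact: near_join. Qed.

Lemma gf_eqP xi eta y : gf_eq_at xi eta y <-> xi y = eta y.
Proof. by split=> [?|e s]; [apply/funext|rewrite e]. Qed.

Lemma gf_germ k xi eta x : gf k xi x ->
  (\forall y \near x, gf_eq_at xi eta y) -> gf k eta x.
Proof.
move=> /gfP gxi /near_near_and e; apply/gfP.
apply: filterS2 gxi e => y [mx sx dx rx] [/gf_eqP ey ne].
split; rewrite -?ey// => L Ly; apply: (reg_germ (rx _ Ly)).
by apply: filterS ne => z ->.
Qed.

Lemma gf_at k xi x : gf k xi x ->
  [/\ multilinear_form (xi x), graded_symmetric (xi x), form_degree k (xi x)
    & gf_regular xi x].
Proof. by move=> /gfP/nbhs_singleton. Qed.

Lemma gf_gf_lin k f xi eta x : reg f x -> gf k xi x -> gf k eta x ->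
  gf k (gf_lin f xi eta) x.
Proof.
move=> /reg_near rf /gfP gx /gfP ge; apply/gfP.
near=> y.
have [mx sx dx rx] : [/\ multilinear_form (xi y), graded_symmetric (xi y),
  form_degree k (xi y) & gf_regular xi y] by near: y.
have [me se de re] : [/\ multilinear_form (eta y), graded_symmetric (eta y),
  form_degree k (eta y) & gf_regular eta y] by near: y.
rewrite /gf_lin; split.
- by move=> s t i a u v; rewrite mx me; ring.
- by move=> s t u v; rewrite sx se; ring.
- by move=> s ds; rewrite dx// de// mulr0 addr0.
- by move=> L Ly; apply: reg_lin; [near: y|apply: rx|apply: re].
Unshelve. all: by end_near. Qed.

Lemma gf0 k x : gf k (gf_of_fun E (fun=> 0)) x.
Proof.
have E0 y l : gf_of_fun E (fun=> 0) y l = 0 by case: l.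
apply/gfP; apply: nearW => y; split.
- by move=> *; rewrite !E0 mulr0 addr0.
- by move=> *; rewrite !E0 mulr0.
- by move=> *; rewrite !E0.
- move=> L _; apply: (@reg_germ _ _ _ _ (fun=> 0)); first exact: reg_cst.
  by apply: nearW => z; rewrite E0.
Qed.

Lemma gf_gf_of_fun f x : reg f x -> gf 0 (gf_of_fun E f) x.
Proof.
move=> /reg_near rf; apply/gfP; apply: filterS rf => y fy; split.
- by move=> [|? ?] t i a u v /=; rewrite mulr0 addr0.
- by move=> [|? ?] t u v /=; rewrite mulr0.
- by case=> [|v s]; rewrite ?big_nil.
- move=> [|s L] _ //=.
  exact: reg_cst.
Qed.

(** With the weights 1/m this inverts the Euler operator in positive arity. *)
Lemma gf_arity k (w : nat -> K) xi x : gf k xi x ->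
  gf k (fun y l => w (size l) * xi y l) x.
Proof.
move=> /gfP gx; apply/gfP; apply: filterS gx => y [mx sx dx rx]; split.
- by move=> *; rewrite mx !size_cat /=; ring.
- by move=> *; rewrite sx !size_cat /=; ring.
- by move=> *; rewrite dx ?mulr0.
- move=> L Ly.
  apply: (@reg_germ _ _ _ _
    (fun z => w (size L) * xi z [seq hsec_at s z | s <- L])).
    by apply: reg_mul; [exact: reg_cst|exact: rx].
  by apply: nearW => z; rewrite size_map.
Qed.

Lemma gf_contract i (s : forall y, fib (E i) y) k xi x : vreg s x ->
  gf (i.+1 + k) xi x -> gf k (contract (existT _ i s) xi) x.
Proof.
move=> /vreg_near rs /gfP gx; apply/gfP.
apply: filterS2 rs gx => y sy [mx sx dx rx]; rewrite /contract; split.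
- by move=> t t' *; apply: (mx (_ :: t)).
- by move=> t t' *; apply: (sx (_ :: t)).
- by move=> t dt; apply: dx; rewrite big_cons eqn_add2l.
- by move=> L Ly; apply: (rx (existT _ i s :: L)).
Qed.

Lemma fmul_regular p xi eta y L : gf_regular xi y -> gf_regular eta y ->
  all_vreg L y -> reg (fun z => fmul p (xi z) (eta z)
    [seq hsec_at s z | s <- L]) y.
Proof.
elim: L p xi eta => [|s L IH] p xi eta rx re Ly /=.
  by apply: reg_mul; [apply: (rx [::])|apply: (re [::])].
case: Ly => sy Ly; apply: reg_add.
  apply: (IH (p + (tag s).+1)%N (contract s xi) eta) => //.
  by move=> L' L'y; apply: (rx (s :: L')).
apply: reg_mul; first exact: (reg_cst ((-1) ^+ (p * (tag s).+1)) y).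
apply: (IH _ xi (contract s eta)) => //.
by move=> L' L'y; apply: (re (s :: L')).
Qed.

Lemma gf_gmul p q xi eta x : gf p xi x -> gf q eta x ->
  gf (p + q) (gmul p xi eta) x.
Proof.
move=> /gfP gx /gfP ge; apply/gfP.
apply: filterS2 gx ge => y [mx sx dx rx] [me se de re]; split.
- exact: fmul_multilinear.
- exact: fmul_symmetric.
- exact: fmul_degree.
- by move=> L Ly; apply: fmul_regular.
Qed.

Definition dual_gfun i (co : forall y, fib (E i) y -> K) : gfun E :=
  fun y => dual_form (co y).

Lemma dual_frame_covector i r (e : 'I_r -> forall y, fib (E i) y) co x k :
  (\forall y \near x, frame_at e co y) -> covector i (dual_gfun (co k)) x.
Proof.
move=> nf; split; last by apply: nearW => y s; apply: dual_form_arity1.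
apply/gfP; apply: filterS nf => y fy; split.
- move=> s t j a u v; rewrite /dual_gfun.
  have [st|] := eqVneq (size (s ++ hv u :: t)) 1%N; last first.
    by move=> st; rewrite !dual_form_arity1 ?mulr0 ?addr0//;
      move: st; rewrite !size_cat.
  move: st; rewrite size_cat /= addnS => -[] /eqP.
  rewrite addn_eq0 !size_eq0 => /andP[/eqP-> /eqP->] /=.
  have [ji|ji] := eqVneq j i; last by rewrite !dual_form_neq// mulr0 addr0.
  by subst j; rewrite !dual_form1 (frame_lin fy).
- by move=> s t u v; rewrite /dual_gfun !(@dual_form_arity1 _ _ _ _ _ _ _
    (co k y)) ?mulr0//
    size_cat /=; lia.
- exact: dual_form_degree.
- move=> L Ly; rewrite /dual_gfun.
  case: L Ly => [|[j s] [|s' L]] /=; [by move=> _; exact: reg_cst| |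
    by move=> _; exact: reg_cst].
  move=> [/= sy _]; have [ji|ji] := eqVneq j i.
    subst j; move/(frame_reg fy): sy => /(_ k) sy; apply: (reg_germ sy).
    by apply: nearW => z; rewrite dual_form1.
  apply: (@reg_germ _ _ _ _ (fun=> 0)); first exact: reg_cst.
  by apply: nearW => z; rewrite dual_form_neq.
Qed.

(** The filtration by powers of the ideal of functions without constant term, in degree k. *)
Definition gf_ge m k xi x :=
  gf k xi x /\ \forall y \near x, forall l, (size l < m)%N -> xi y l = 0.

Lemma gf_ge1 k xi x : k != 0%N -> gf k xi x -> gf_ge 1 k xi x.
Proof.
move=> k0 gx; split=> //; apply: filterS gx => y [_ _ dx _] [|//] _.
by apply: dx; rewrite big_nil eq_sym.
Qed.

Lemma local_frames x : exists r (e : forall i, 'I_(r i) -> forall y,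
  fib (E i) y)
    (co : forall i, 'I_(r i) -> forall y, fib (E i) y -> K),
  forall i, \forall y \near x, frame_at (e i) (co i) y.
Proof.
pose F i := cid (local_frame (E i) x).
pose G i := cid (projT2 (F i)).
pose H i := cid (projT2 (G i)).
exists (fun i => projT1 (F i)), (fun i => projT1 (G i)),
  (fun i => projT1 (H i)).
by move=> i; apply: (projT2 (H i)).
Qed.

Lemma has_tag_degree p y (s : seq (hvec E y)) :
  has (fun h => p <= tag h)%N s -> (p < \sum_(v <- s) hdeg v)%N.
Proof.
elim: s => // h s IH /=; rewrite big_cons => /orP[ph|/IH].
  by rewrite (leq_trans _ (leq_addr _ _)).
by move=> ps; rewrite (leq_trans ps)// leq_addl.
Qed.

(* Euler's identity applied to xi / arity writes xi as the sum over a frame of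
   the products of eps^k with the contraction of xi / arity with e_k. *)
Lemma gf_frame_ind m p x r (e : forall i, 'I_(r i) -> forall y, fib (E i) y)
    (co : forall i, 'I_(r i) -> forall y, fib (E i) y -> K) (P : gfun E -> Prop)
      :
  (forall i, (i < p)%N -> \forall y \near x, frame_at (e i) (co i) y) ->
  (forall xi eta, gf p xi x -> gf p eta x ->
    (\forall y \near x, gf_eq_at xi eta y) -> P xi -> P eta) ->
  P (gf_of_fun E (fun=> 0)) ->
  (forall xi eta, gf p xi x -> gf p eta x -> P xi -> P eta ->
    P (gf_lin (fun=> 1) xi eta)) ->
  (forall q s (k : 'I_(r q)) eta, p = (q.+1 + s)%N -> gf_ge m s eta x ->
    P (gmul q.+1 (dual_gfun (co q k)) eta)) ->
  forall xi, gf_ge m.+1 p xi x -> P xi.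
Proof.
move=> nf Pe P0 Plin Pmul xi [gx x0].
(* In arity 0 the inverse of 0 is 0, which is harmless since xi vanishes there. *)
pose xi' : gfun E := fun y l => (size l)%:R^-1 * xi y l.
have gx' : gf p xi' x by apply: (gf_arity (fun k => k%:R^-1) gx).
pose Q eta := gf p eta x /\ P eta.
have Qsum (I : Type) (s : seq I) F : (forall i, Q (F i)) ->
    Q (fun y l => \sum_(i <- s) F i y l).
  move=> QF; elim: s => [|i s [g1 P1]].
    rewrite (_ : (fun y l => _) = gf_of_fun E (fun=> 0)).
      by split=> //; exact: gf0.
    by apply: functional_extensionality_dep => y; apply/funext => -[|? ?];
      rewrite big_nil.
  rewrite (_ : (fun y l => _) = gf_lin (fun=> 1) (F i)
      (fun y l => \sum_(j <- s) F j y l)); last first.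
    by apply: functional_extensionality_dep => y; apply/funext => l;
      rewrite big_cons /gf_lin mul1r.
  have [gi Pi] := QF i; split; last exact: Plin.
  by apply: gf_gf_lin => //; exact: reg_cst.
pose T (i : 'I_p) (k : 'I_(r i)) : gfun E :=
  gmul i.+1 (dual_gfun (co i k)) (contract (existT _ (i : nat) (e i k)) xi').
have [gS PS] : Q (fun y l => \sum_(i < p) \sum_(k < r i) T i k y l).
  have := Qsum _ (index_enum 'I_p)
    (fun i y l => \sum_(k <- index_enum 'I_(r i)) T i k y l).
  apply=> i; apply: Qsum => k.
  have cv : covector i (dual_gfun (co i k)) x.
    by apply: dual_frame_covector (nf i _).
  have ip : p = (i.+1 + (p - i.+1))%N by rewrite subnKC.
  have ge : gf_ge m (p - i.+1) (contract (existT _ (i : nat) (e i k)) xi') x.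
    split; last by apply: filterS x0 => y x0 l lm;
      rewrite /contract /xi' x0 ?mulr0.
    apply: gf_contract; last by rewrite -ip.
    by have /nbhs_singleton/frame_sec := nf i (ltn_ord i); apply.
  by split; [rewrite [X in gf X]ip; apply: gf_gmul; [exact: cv.1|exact: ge.1]
            |exact: Pmul ip ge].
apply: Pe gS gx _ PS; near=> y => l.
have fy : forall i : 'I_p, frame_at (e i) (co i) y.
  by near: y; apply: filter_forall => i; exact: nf.
have [mx' sx' dx' _] : [/\ multilinear_form (xi' y), graded_symmetric (xi' y),
  form_degree p (xi' y) & gf_regular xi' y] by near: y; apply/gfP.
rewrite (@euler_sum _ _ _ _ _ _ p r (fun i k => e i k y) (fun i k => co i k y)
    _ (xi' y))//.
- rewrite /xi'; case: l => [|h l].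
    by rewrite mul0r; apply/esym; move: [::]
      (isT : (size (@nil (hvec E y)) < m.+1)%N); near: y.
  by rewrite mulrA divff ?mul1r// pnatr_eq0.
- by move=> i ip v; exact: (frame_id (fy (Ordinal ip))).
- by move=> s /has_tag_degree ps; apply: dx'; rewrite neq_ltn ps orbT.
Unshelve. all: by end_near. Qed.

Lemma gf_prod_ind m p x (P : gfun E -> Prop) :
  (forall xi eta, gf p xi x -> gf p eta x ->
    (\forall y \near x, gf_eq_at xi eta y) -> P xi -> P eta) ->
  P (gf_of_fun E (fun=> 0)) ->
  (forall xi eta, gf p xi x -> gf p eta x -> P xi -> P eta ->
    P (gf_lin (fun=> 1) xi eta)) ->
  (forall q r al eta, p = (q.+1 + r)%N -> covector q al x ->
    gf_ge m r eta x -> P (gmul q.+1 al eta)) ->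
  forall xi, gf_ge m.+1 p xi x -> P xi.
Proof.
move=> Pe P0 Plin Pmul; have [r [e [co nf]]] := local_frames x.
apply: (gf_frame_ind (e := e) (co := co)) => // q s k eta pqs ge.
by apply: Pmul pqs _ ge; apply: dual_frame_covector (nf q).
Qed.

End GradedFunctionOperations.

(** * The homological vector field in low arity *)

Section Covectors.
Context {R : realType} {c : geometry} {n : nat} {M : manifold R c n}.
Local Notation K := (scalars R c).
Variable E : nat -> vbundle M.
Implicit Types (x y : M) (xi eta al be : gfun E).

Lemma covector_near k al x : covector k al x -> \forall y \near x,
  covector k al y.
Proof.
move=> [/gf_near ga /near_join na].
by apply: filterS2 ga na.
Qed.

Lemma covector_arity1 k al x : covector k al x -> arity1 (al x).
Proof. by move=> [_ /nbhs_singleton]. Qed.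

Lemma covector_nil k al x : covector k al x -> al x [::] = 0.
Proof. by move=> /covector_arity1; apply. Qed.

Lemma covector_sep k x (w w' : fib (E k) x) :
  (forall al, covector k al x -> al x [:: hv w] = al x [:: hv w']) -> w = w'.
Proof.
move=> ww'; have [r [e [co nf]]] := local_frame (E k) x.
have fx := nbhs_singleton nf.
rewrite (frame_id fx w) (frame_id fx w'); apply: eq_bigr => l _; congr (_ *: _).
by have := ww' _ (dual_frame_covector l nf); rewrite /dual_gfun !dual_form1.
Qed.

End Covectors.

Section Algebroid.
Context {R : realType} {c : geometry} {n : nat} {M : manifold R c n}.
Local Notation K := (scalars R c).
Variable E : lie_infty_algebroid M.
Implicit Types (x y : M) (xi eta al : gfun E).

(** The value 0 on E_{-1} leaves the anchor to [rho] and makes the formulas for Q uniform in the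
    index. *)
Definition lin_precomp (W : zmodType) y (G : forall i, fib (E i) y -> W) i :
    fib (E i) y -> W :=
  match i return fib (E i) y -> W with
  | 0 => fun=> 0
  | i'.+1 => fun v => G i' (lin E i' y v)
  end.

(** The anchor in index 0. In higher indices it vanishes on regular functions by degree ([rho_pos]),
    which again avoids case distinctions. *)
Definition rho y i (v : fib (E i) y) (g : M -> K) : K :=
  Q E (gf_of_fun E g) y [:: hv v].

Lemma Q_eq0 k xi x : gf k xi x -> (\forall y \near x, forall l, xi y l = 0) ->
  forall l, Q E xi x l = 0.
Proof.
move=> gx x0 l.
have r0 : reg (fun=> -1 : K) x by exact: reg_cst.
rewrite (Q_germ (l := E) gx (gf0 E k x)); last first.
  by apply: filterS x0 => y x0 s; rewrite x0; case: s.
have := Q_lin (l := E) (-1) (gf0 E k x) (gf0 E k x) l.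
rewrite (_ : gf_lin _ _ _ = gf_of_fun E (fun=> 0)); last first.
  apply: functional_extensionality_dep => y; apply/funext => s.
  by rewrite /gf_lin mulN1r addNr; case: s.
by rewrite /gf_lin mulN1r addNr.
Qed.

Lemma rho_eq0 x i (v : fib (E i) x) g : (\forall y \near x, g y = 0) ->
  rho v g = 0.
Proof.
move=> g0; apply: (Q_eq0 (k := 0)).
  apply: gf_germ (gf0 E 0 x) _.
  by apply: filterS g0 => y g0 [|? ?]//=.
by apply: filterS g0 => y g0 [|? ?].
Qed.

Lemma Q_covector1 k al x i (v : fib (E i) x) : covector k al x ->
  Q E al x [:: hv v] = (-1) ^+ i * lin_precomp (fun j w => al x [:: hv w]) v.
Proof.
move=> cal; have [ik|ik] := eqVneq i k.+1.
  by subst i; rewrite /= -[LHS]/(pairing _ v) linP.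
have [_ _ dQ _] := gf_at (Q_deg (l := E) cal.1).
rewrite (form_degree1 _ dQ) 1?eqSS 1?eq_sym//.
case: i v ik => [|i] v ik /=; first by rewrite mulr0.
have [_ _ dal _] := gf_at cal.1.
by rewrite (form_degree1 _ dal) ?mulr0// eq_sym.
Qed.

Lemma fmul1 p x (X Y : seq (hvec E x) -> K) u : X [::] = 0 ->
  fmul p X Y [:: u] = X [:: u] * Y [::].
Proof. by move=> X0 /=; rewrite X0 mul0r mulr0 addr0. Qed.

Lemma gf_nil p xi x : gf p.+1 xi x -> xi x [::] = 0.
Proof. by case/gf_at => _ _ /form_degree0-> //. Qed.

(** In Q(al eta), the term al Q(eta) has no arity 1 part because Q(eta) has positive degree. What
    remains is Q(al) times the constant part of eta, and Q(al) is given by [Q_covector1]. *)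
Lemma Q1_pos p xi x i (v : fib (E i) x) : gf p.+1 xi x ->
  Q E xi x [:: hv v] = (-1) ^+ i * lin_precomp (fun j w => xi x [:: hv w]) v.
Proof.
move=> /(gf_ge1 (k := p.+1) isT); move: xi; apply: gf_prod_ind.
- move=> xi eta gx ge nxe; have /gf_eqP xe := nbhs_singleton nxe => Pxi.
  by rewrite -(Q_germ (l := E) gx ge nxe) Pxi xe.
- rewrite (Q_eq0 (gf0 E 0 x)); last by apply: nearW => y [].
  by case: i v => [|i] v /=; rewrite mulr0.
- move=> xi eta gx ge Px Pe; rewrite (Q_lin (l := E) 1 gx ge) /gf_lin Px Pe.
  by case: i v {Px Pe} => [|i] v /=; ring.
- move=> q r al eta _ cal [ge _].
  rewrite (Q_der (l := E) cal.1 ge) /gf_lin /gmul.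
  rewrite (fmul1 _ _ _ (covector_nil cal)) (gf_nil (Q_deg (l := E) ge)).
  rewrite (fmul1 _ _ _ (gf_nil (Q_deg (l := E) cal.1))) (Q_covector1 v cal).
  rewrite !mulr0 add0r.
  case: i v => [|i] v /=; first by rewrite mulr0 mul0r.
  by rewrite (covector_nil cal); ring.
Qed.

Lemma Q1 p xi x i (v : fib (E i) x) : gf p xi x ->
  Q E xi x [:: hv v] = (-1) ^+ i * lin_precomp (fun j w => xi x [:: hv w]) v
    + rho v (fun z => xi z [::]).
Proof.
case: p => [|p] gx; last first.
  rewrite (Q1_pos _ gx) rho_eq0 ?addr0//.
  by apply: filterS (gf_near gx) => y; apply: gf_nil.
have nx : \forall y \near x, gf_eq_at xi (gf_of_fun E (fun z => xi z [::])) y.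
  apply: filterS (gf_near gx) => y /gf_at[_ _ dy _] [|h s]//=.
  by apply: dy; rewrite big_cons.
rewrite (_ : (_ ^+ i * _) = 0); last first.
  case: i v => [|i] v /=; first by rewrite mulr0.
  by rewrite (nbhs_singleton nx) /= mulr0.
rewrite add0r /rho; apply: (Q_germ (l := E) gx _ nx).
exact: gf_germ gx nx.
Qed.

(** The arity 2 part of Q(al), which encodes the bracket, enters only through the constant part of
    eta; all other terms come from the anchor and the differential. *)
Lemma Q_gmul2 q r al eta x i j (u : fib (E i) x) (v : fib (E j) x) :
  covector q al x -> gf r eta x ->
  Q E (gmul q.+1 al eta) x [:: hv u; hv v] =
    Q E al x [:: hv u; hv v] * eta x [::]
    + (-1) ^+ i.+1 * al x [:: hv u] * rho v (fun z => eta z [::])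
    + (-1) ^+ (i * j.+1) * al x [:: hv v] * rho u (fun z => eta z [::])
    + (-1) ^+ i * lin_precomp (fun k w => gmul q.+1 al eta x [:: hv w; hv v]) u
    + (-1) ^+ (i + j).+1 * lin_precomp (fun k w =>
        gmul q.+1 al eta x [:: hv u; hv w]) v.
Proof.
move=> cal ge; have a1 := covector_arity1 cal.
have [_ _ da _] := gf_at cal.1.
have mulE Y h h' : fmul q.+1 (al x) Y [:: h; h'] =
    al x [:: h] * Y [:: h'] + (-1) ^+ (q.+1 * hdeg h) *
      (al x [:: h'] * Y [:: h]).
  by rewrite !fmul_covector_cons// fmul_covector_nil// mulr0 addr0.
pose A k (w : fib (E k) x) := al x [:: hv w].
pose B k (w : fib (E k) x) := eta x [:: hv w].
have -> : lin_precomp (fun k w => gmul q.+1 al eta x [:: hv w; hv v]) u =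
    lin_precomp A u * B _ v + (-1) ^+ (q.+1 * i) * (A _ v * lin_precomp B u).
  by case: (i) u => [|i'] u' /=; rewrite ?mul0r ?mulr0 ?addr0// /gmul mulE.
have -> : lin_precomp (fun k w => gmul q.+1 al eta x [:: hv u; hv w]) v =
    A _ u * lin_precomp B v + (-1) ^+ (q.+1 * i.+1) * (lin_precomp A v * B _ u).
  by case: (j) v => [|j'] v' /=; rewrite ?mul0r ?mulr0 ?addr0// /gmul mulE.
rewrite (Q_der (l := E) cal.1 ge) /gf_lin /gmul mulE /=.
rewrite (gf_nil (Q_deg (l := E) cal.1)) !(Q_covector1 _ cal) !(Q1 _ ge).
rewrite -/A -/B mul0r mulr0 addr0.
rewrite -/(A i u) -/(A j v) -/(B i u) -/(B j v) /hdeg /=.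
(* A covector of degree q.+1 is nonzero only on vectors of index q. A surviving term thus ties the
   parity of q to those of i or j, and the signs are compared parity by parity. *)
have Ha k (w : fib (E k) x) : q = k \/ A k w = 0.
  have [|qi] := eqVneq q k; [by left|right].
  by rewrite /A (form_degree1 _ da)// eqSS.
have dA k (w : fib (E k) x) : q.+1 = k \/ lin_precomp A w = 0.
  by case: k w => [|k] w; [right|have [->|] := Ha _ (lin E k x w);
    [left|right]].
have := (Ha _ u, Ha _ v); have := (dA _ u, dA _ v).
move: (A _ u) (A _ v) (lin_precomp A u) (lin_precomp A v) => a a' d d'.
move: (B _ u) (B _ v) (lin_precomp B u) (lin_precomp B v) =>
  b b' f f' [da1 da2] [a1' a2'].
have par (m k : nat) (t : K) : m = k \/ t = 0 -> odd m = odd k \/ t = 0.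
  by case=> [->|]; [left|right].
move: a1' a2' da1 da2 => /par a1' /par a2' /par d1 /par d2.
have sgE m : (-1 : K) ^+ m = if odd m then -1 else 1.
  by rewrite -signr_odd; case: odd.
rewrite !sgE !(oddD, oddM, oddS) /=.
move: a1' a2' d1 d2 => /=; move: (odd q) (odd i) (odd j) => [] [] [] /=.
all: (case=> [?|->]; last case=> [?|->]); try by [].
all: (case=> [?|->]; last case=> [?|->]); try by [].
all: try (case=> [?|->]; try by []).
all: try (case=> [?|->]; try by []).
all: by ring.
Qed.

(** In a product al eta, eta has no constant part near x, which removes both the anchor terms and
    the bracket term of [Q_gmul2]. *)
Lemma Q_ge2 p tau x i j (u : fib (E i) x) (v : fib (E j) x) : gf_ge 2 p tau x ->
  Q E tau x [:: hv u; hv v] =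
    (-1) ^+ i * lin_precomp (fun k w => tau x [:: hv w; hv v]) u
    + (-1) ^+ (i + j).+1 * lin_precomp (fun k w => tau x [:: hv u; hv w]) v.
Proof.
move: tau; apply: gf_prod_ind.
- move=> xi eta gx ge nxe; have /gf_eqP xe := nbhs_singleton nxe => Pxi.
  by rewrite -(Q_germ (l := E) gx ge nxe) Pxi xe.
- rewrite (Q_eq0 (gf0 E 0 x)); last by apply: nearW => y [].
  by case: i u => [|i] u; case: j v => [|j] v /=; rewrite !mulr0 addr0.
- move=> xi eta gx ge Px Pe; rewrite (Q_lin (l := E) 1 gx ge) /gf_lin Px Pe.
  by case: i u {Px Pe} => [|i] u; case: j v => [|j] v /=; ring.
- move=> q r al eta _ cal [ge e0].
  have ne0 : \forall y \near x, eta y [::] = 0 by apply: filterS e0 => y; apply.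
  rewrite (Q_gmul2 _ _ cal ge) (nbhs_singleton ne0) !rho_eq0//.
  by rewrite !mulr0 !add0r.
Qed.

Lemma rho_pos x i (v : fib (E i.+1) x) g : reg g x -> rho v g = 0.
Proof.
move=> rg; have [_ _ dQ _] := gf_at (Q_deg (l := E) (gf_gf_of_fun E rg)).
exact: form_degree1 dQ _.
Qed.

Lemma rho_lin x g i a (u v : fib (E i) x) : reg g x ->
  rho (a *: u + v) g = a * rho u g + rho v g.
Proof.
move=> rg; have [m _ _ _] := gf_at (Q_deg (l := E) (gf_gf_of_fun E rg)).
exact: (m [::] [::]).
Qed.

Lemma QQ k xi x l : gf k xi x -> Q E (Q E xi) x l = 0.
Proof. by move=> gx; rewrite (Q_sq (l := E) gx); case: l. Qed.

(** Q^2 = 0 on covectors, read in arity 1. *)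
Lemma lin_lin x i (v : fib (E i.+2) x) : lin E i x (lin E i.+1 x v) = 0.
Proof.
apply: covector_sep => al cal.
have [mal _ _ _] := gf_at cal.1; rewrite (multilinear_form0 [::] [::] _ mal).
have := QQ [:: hv v] cal.1; rewrite (Q1_pos _ (Q_deg (l := E) cal.1)) /=.
rewrite (Q_covector1 _ cal) /= => /eqP.
by rewrite !mulf_eq0 !signr_eq0 oppr_eq0 oner_eq0 => /= /eqP.
Qed.

(** Q^2 = 0 on functions, read in arity 1. *)
Lemma rho_lin0 x (v : fib (E 1) x) g : reg g x -> rho (lin E 0 x v) g = 0.
Proof.
move=> rg; have gg := gf_gf_of_fun E rg.
have := QQ [:: hv v] gg; rewrite (Q1_pos _ (Q_deg (l := E) gg)) /= => /eqP.
by rewrite mulf_eq0 signr_eq0 => /= /eqP.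
Qed.

Definition null_anchor x i (v : fib (E i) x) := forall g, reg g x ->
  rho v g = 0.

(* For u, v with null anchors, w is, up to sign, the binary bracket of u and v.
  *)
Lemma Q_null_anchor p x i j (u : fib (E i) x) (v : fib (E j) x) :
  null_anchor u -> null_anchor v -> exists w : fib (E p) x,
  forall xi, gf p.+1 xi x -> Q E xi x [:: hv u; hv v] = xi x [:: hv w]
    + (-1) ^+ i * lin_precomp (fun k w => xi x [:: hv w; hv v]) u
    + (-1) ^+ (i + j).+1 * lin_precomp (fun k w => xi x [:: hv u; hv w]) v.
Proof.
move=> u0 v0; have [r [e [co nf]]] := local_frames E x.
pose d (k : 'I_(r p)) : gfun E := dual_gfun (co p k).
(* These coordinates are forced by the identity for the coframe elements of degree p.+1. *)
exists (\sum_k Q E (d k) x [:: hv u; hv v] *: e p k x).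
set w := \sum_k _; have fx := nbhs_singleton (nf p).
have dw k : d k x [:: hv w] = Q E (d k) x [:: hv u; hv v].
  rewrite /d /dual_gfun dual_form1.
  exact: frame_coord fx.
move=> xi /(gf_ge1 (k := p.+1) isT); move: xi.
apply: (gf_frame_ind (e := e) (co := co)) => //.
- move=> xi eta gx ge nxe; have /gf_eqP xe := nbhs_singleton nxe => Pxi.
  by rewrite -(Q_germ (l := E) gx ge nxe) Pxi xe.
- rewrite (Q_eq0 (gf0 E 0 x)); last by apply: nearW => y [].
  by case: (i) (u) => [|i'] u'; case: (j) (v) => [|j'] v' /=;
    rewrite !mulr0 !addr0.
- move=> xi eta gx ge Px Pe; rewrite (Q_lin (l := E) 1 gx ge) /gf_lin Px Pe.
  by case: (i) (u) => [|i'] u'; case: (j) (v) => [|j'] v' /=; ring.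
- move=> q s k eta pqs [ge _].
  have cal := dual_frame_covector k (nf q).
  have re : reg (fun z => eta z [::]) x by case: (gf_at ge) => _ _ _ rx;
    apply: (rx [::]).
  rewrite (Q_gmul2 _ _ cal ge) u0// v0// !mulr0 !addr0; congr (_ + _ + _).
  rewrite /gmul (fmul1 _ _ _ (covector_nil cal)).
  case: s pqs ge => [|s] pqs ge; last by rewrite (gf_nil ge) !mulr0.
  move: pqs; rewrite addn0 => -[pq]; subst q.
  by rewrite -/(d k) dw.
Qed.

(** Up to sign, the coordinates of the image are Q of the coframe evaluated on s, and Q preserves
    regularity. *)
Lemma lin_regular i x (s : forall y, fib (E i.+1) y) : vreg s x ->
  vreg (fun y => lin E i y (s y)) x.
Proof.
move=> rs; have [r [e [co nf]]] := local_frame (E i) x.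
apply/(frame_reg (nbhs_singleton nf)) => k.
have cd := dual_frame_covector k nf.
have [_ _ _ rQ] := gf_at (Q_deg (l := E) cd.1).
apply: (@reg_germ _ _ _ _ (fun y => (-1) ^+ i.+1 *
   Q E (dual_gfun (co k)) y [seq hsec_at t y | t <- [:: existT _ i.+1 s]])).
  by apply: reg_mul; [exact: reg_cst|apply: rQ].
apply: filterS (covector_near cd) => y cdy; rewrite /= /hsec_at /=.
rewrite (Q_covector1 _ cdy) /= /dual_gfun dual_form1 mulrA -exprD addnn.
by rewrite -mul2n exprM sqrrN !expr1n mul1r.
Qed.

End Algebroid.

(** * Lifting bundle maps through a resolution *)

Section BundleMaps.
Context {R : realType} {c : geometry} {n : nat} {M : manifold R c n}.
Local Notation K := (scalars R c).
Implicit Types (x y : M) (V W : vbundle M).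

(** A predicate and not a bundled linear map: the maps built below exist at every point but are
    linear only near x. *)
Definition linear_fun (U W : lmodType K) (f : U -> W) :=
  forall a u v, f (a *: u + v) = a *: f u + f v.

Lemma linear_fun0 (U W : lmodType K) (f : U -> W) : linear_fun f -> f 0 = 0.
Proof.
by move=> lf; have := lf (-1) 0 0; rewrite scaler0 addr0 scaleN1r addNr.
Qed.

Lemma linear_fun_sum (U W : lmodType K) (f : U -> W) (I : Type) (r : seq I)
    (a : I -> K) (u : I -> U) : linear_fun f ->
  f (\sum_(i <- r) a i *: u i) = \sum_(i <- r) a i *: f (u i).
Proof.
move=> lf; elim: r => [|i r IH]; first by rewrite !big_nil linear_fun0.
by rewrite !big_cons lf IH.
Qed.

Definition bundle_map V W (f : forall y, fib V y -> fib W y) x :=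
  \forall y \near x, linear_fun (f y) /\
    forall s, vreg s y -> vreg (fun z => f z (s z)) y.

Definition bilinear_map V V' W (B : forall y, fib V y -> fib V' y -> fib W y) x
  :=
  \forall y \near x,
    [/\ forall v, linear_fun (fun u => B y u v), forall u, linear_fun (B y u) &
      forall s t, vreg s y -> vreg t y -> vreg (fun z => B z (s z) (t z)) y].

Lemma bundle_map_comp V V' W (f : forall y, fib V y -> fib V' y)
    (g : forall y, fib V' y -> fib W y) x :
  bundle_map f x -> bundle_map g x -> bundle_map (fun y v => g y (f y v)) x.
Proof.
apply: filterS2 => y [lf rf] [lg rg]; split=> [a u v|s rs].
  by rewrite lf lg.
exact: rg _ (rf _ rs).
Qed.

Lemma bundle_map_lin V W a (f g : forall y, fib V y -> fib W y) x :
  bundle_map f x -> bundle_map g x -> bundle_map (fun y v => a *: f y v + g y v)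
    x.
Proof.
apply: filterS2 => y [lf rf] [lg rg]; split=> [b u v|s rs].
  by rewrite lf lg scalerDr !scalerA [a * b]mulrC scalerDr scalerA addrACA.
apply: vreg_lin (rf _ rs) (rg _ rs); exact: reg_cst.
Qed.

Lemma bundle_mapB V W (f g : forall y, fib V y -> fib W y) x :
  bundle_map f x -> bundle_map g x -> bundle_map (fun y v => f y v - g y v) x.
Proof.
move=> bf bg; apply: filterS (bundle_map_lin (-1) bg bf) => y [l r].
split=> [a u v|s rs]; first by have := l a u v;
  rewrite !scaleN1r !(addrC (- _)).
apply: vreg_germ (r _ rs) _; apply: nearW => z; by rewrite scaleN1r addrC.
Qed.

Lemma bilinear_map_lin V V' W a
    (B C : forall y, fib V y -> fib V' y -> fib W y) x :
  bilinear_map B x -> bilinear_map C x ->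
  bilinear_map (fun y u v => a *: B y u v + C y u v) x.
Proof.
apply: filterS2 => y [lB lB' rB] [lC lC' rC]; split=>
  [v b u u'|u b v v'|s t rs rt].
- by rewrite lB lC scalerDr !scalerA [a * b]mulrC scalerDr scalerA addrACA.
- by rewrite lB' lC' scalerDr !scalerA [a * b]mulrC scalerDr scalerA addrACA.
- apply: vreg_lin (rB _ _ rs rt) (rC _ _ rs rt); exact: reg_cst.
Qed.

Lemma bilinear_map0 V V' W x : bilinear_map
  (fun y (_ : fib V y) (_ : fib V' y) =>
  0 : fib W y) x.
Proof.
apply: nearW => y; split=> [v a u u'|u a v v'|s t _ _].
- by rewrite scaler0 addr0.
- by rewrite scaler0 addr0.
- exact: vreg0.
Qed.

Lemma bilinear_map_compl V V' V1 W (B : forall y, fib V y -> fib V' y ->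
  fib W y)
    (f : forall y, fib V1 y -> fib V y) x :
  bundle_map f x -> bilinear_map B x ->
  bilinear_map (fun y u v => B y (f y u) v) x.
Proof.
apply: filterS2 => y [lf rf] [lB lB' rB]; split=> [v a u u'|u a v v'|s t rs rt].
- by rewrite lf lB.
- by rewrite lB'.
- exact: rB _ _ (rf _ rs) rt.
Qed.

Lemma bilinear_map_compr V V' V1 W (B : forall y, fib V y -> fib V' y ->
  fib W y)
    (f : forall y, fib V1 y -> fib V' y) x :
  bundle_map f x -> bilinear_map B x ->
  bilinear_map (fun y u v => B y u (f y v)) x.
Proof.
apply: filterS2 => y [lf rf] [lB lB' rB]; split=> [v a u u'|u a v v'|s t rs rt].
- by rewrite lB.
- by rewrite lf lB'.
- exact: rB _ _ rs (rf _ rt).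
Qed.

Lemma frame_map V W r (e : 'I_r -> forall y, fib V y) co
    (t : 'I_r -> forall y, fib W y) x :
  (\forall y \near x, frame_at e co y) -> (forall k, vreg (t k) x) ->
  bundle_map (fun y v => \sum_k co k y v *: t k y) x.
Proof.
move=> nf rt.
have nt : \forall y \near x, forall k, vreg (t k) y.
  by apply: filter_forall => k; exact: vreg_near (rt k).
apply: filterS2 nf nt => y fy rty; split=> [a u v|s /(frame_reg fy) rs].
  rewrite scaler_sumr -big_split; apply: eq_bigr => k _ /=.
  by rewrite (frame_lin fy) scalerDl scalerA.
exact: vreg_sum.
Qed.

Lemma frame_bilinear_map V V' W r (e : 'I_r -> forall y, fib V y) co
    r' (e' : 'I_r' -> forall y, fib V' y) co'
    (t : 'I_r -> 'I_r' -> forall y, fib W y) x :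
  (\forall y \near x, frame_at e co y) ->
    (\forall y \near x, frame_at e' co' y) ->
  (forall k l, vreg (t k l) x) ->
  bilinear_map (fun y u v => \sum_k co k y u *: \sum_l co' l y v *: t k l y) x.
Proof.
move=> nf nf' rt.
have nt : \forall y \near x, forall k,
    linear_fun (fun v => \sum_l co' l y v *: t k l y) /\
    forall s, vreg s y -> vreg (fun z => \sum_l co' l z (s z) *: t k l z) y.
  by apply: filter_forall => k; apply: (frame_map (t := t k) nf').
apply: filterS2 nf nt => y fy rty; split=> [v a u u'|u a v v'|s s' rs rs'].
- rewrite scaler_sumr -big_split; apply: eq_bigr => k _ /=.
  by rewrite (frame_lin fy) scalerDl scalerA.
- rewrite scaler_sumr -big_split; apply: eq_bigr => k _ /=.
  by rewrite (proj1 (rty k)) scalerDr !scalerA mulrC.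
- apply: (@vreg_sum _ _ _ _ _ _ _ (fun k z => co k z (s z))
    (fun k z => \sum_l co' l z (s' z) *: t k l z)).
    exact/(frame_reg fy).
  by move=> k; apply: (proj2 (rty k)).
Qed.

End BundleMaps.

Section Lifting.
Context {R : realType} {c : geometry} {n : nat} {M : manifold R c n}.
Local Notation K := (scalars R c).
Variables (D : vfop M -> M -> Prop) (E : lie_infty_algebroid M).
Hypothesis uE : universal_resolving E D.
Implicit Types (x y : M).

Lemma cocycle0P y (v : fib (E 0) y) : v \in cocycle E y 0 <-> null_anchor v.
Proof. by rewrite inE. Qed.

Lemma cocycleSP y i (v : fib (E i.+1) y) :
  v \in cocycle E y i.+1 <-> lin E i y v = 0.
Proof. by rewrite inE; split=> [/eqP|->]. Qed.

Lemma lin_linear y i : linear_fun (lin E i y).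
Proof. by move=> a u v; rewrite linearP. Qed.

Lemma lin_bundle_map i x : bundle_map (lin E i) x.
Proof.
apply: nearW => y; split; first exact: lin_linear.
by move=> s; apply: lin_regular.
Qed.

(** Exactness at E_{-1} and further left in one form: in index 0, lying in the kernel of rho_y at
    every y near x means that the anchor of s vanishes as a vector field near x. *)
Lemma exact_section i (s : forall y, fib (E i) y) x : vreg s x ->
  (\forall y \near x, s y \in cocycle E y i) ->
  exists2 t, vreg t x & \forall y \near x, lin E i y (t y) = s y.
Proof.
case: uE => _ ex0 exS; case: i s => [|i] s rs ns.
  apply/(ex0 s x rs); apply: filterS ns => y /cocycle0P s0 f fy.
  exact: s0.
by apply/(exS i s x rs); apply: filterS ns => y /cocycleSP.
Qed.

(** Local sections of V are free on a frame: the finitely many images of frame sections are lifted,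
    and the lift is extended linearly. *)
Lemma lift_bundle_map (V : vbundle M) i (G : forall y, fib V y -> fib (E i) y) x
  :
  bundle_map G x -> (\forall y \near x, forall v, G y v \in cocycle E y i) ->
  exists2 H, bundle_map H x & \forall y \near x, forall v,
    lin E i y (H y v) = G y v.
Proof.
move=> bG cG; have [r [e [co nf]]] := local_frame V x.
have [t tP] : exists t : 'I_r -> forall y, fib (E i.+1) y, forall k,
    vreg (t k) x /\ \forall y \near x, lin E i y (t k y) = G y (e k y).
  apply: (fin_all_exists (P := fun k (t : forall y, fib (E i.+1) y) =>
    vreg t x /\ \forall y \near x, lin E i y (t y) = G y (e k y))) => k.
  have [t rt tG] : exists2 t, vreg t x & \forall y \near x,
      lin E i y (t y) = G y (e k y).
    apply: exact_section; last by apply: filterS cG => y; apply.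
    have [_ rG] := nbhs_singleton bG; apply: rG.
    exact: frame_sec (nbhs_singleton nf) k.
  by exists t.
exists (fun y v => \sum_k co k y v *: t k y).
  by apply: frame_map nf _ => k; case: (tP k).
have nt : \forall y \near x, forall k, lin E i y (t k y) = G y (e k y).
  by apply: filter_forall => k; case: (tP k).
near=> y => v; have fy : frame_at e co y by near: y.
have [lG _] : linear_fun (G y) /\ forall s, vreg s y ->
  vreg (fun z => G z (s z)) y.
  by near: y.
rewrite (linear_fun_sum _ _ _ (@lin_linear y i)) [in RHS](frame_id fy v).
rewrite (linear_fun_sum _ _ _ lG); apply: eq_bigr => k _; congr (_ *: _).
by move: k; near: y.
Unshelve. all: by end_near. Qed.

(** The same for the tensor product, with products of frame sections as a frame. *)
Lemma lift_bilinear_map (V V' : vbundle M) i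
    (G : forall y, fib V y -> fib V' y -> fib (E i) y) x :
  bilinear_map G x -> (\forall y \near x, forall u v, G y u v \in cocycle E y i)
    ->
  exists2 H, bilinear_map H x &
    \forall y \near x, forall u v, lin E i y (H y u v) = G y u v.
Proof.
move=> bG cG; have [r [e [co nf]]] := local_frame V x.
have [r' [e' [co' nf']]] := local_frame V' x.
have [t tP] : exists t : 'I_r -> 'I_r' -> forall y, fib (E i.+1) y, forall k l,
    vreg (t k l) x /\ \forall y \near x,
      lin E i y (t k l y) = G y (e k y) (e' l y).
  apply: (fin_all_exists (P := fun k (t : 'I_r' -> forall y, fib (E i.+1) y) =>
    forall l, vreg (t l) x /\
      \forall y \near x, lin E i y (t l y) = G y (e k y) (e' l y))) => k.
  apply: (fin_all_exists (P := fun l (t : forall y, fib (E i.+1) y) =>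
    vreg t x /\
      \forall y \near x, lin E i y (t y) = G y (e k y) (e' l y))) => l.
  have [t rt tG] : exists2 t, vreg t x & \forall y \near x,
      lin E i y (t y) = G y (e k y) (e' l y).
    apply: exact_section; last by apply: filterS cG => y; apply.
    have [_ _ rG] := nbhs_singleton bG; apply: rG.
      exact: frame_sec (nbhs_singleton nf) k.
    exact: frame_sec (nbhs_singleton nf') l.
  by exists t.
exists (fun y u v => \sum_k co k y u *: \sum_l co' l y v *: t k l y).
  by apply: frame_bilinear_map nf nf' _ => k l; case: (tP k l).
have nt : \forall y \near x, forall k l,
    lin E i y (t k l y) = G y (e k y) (e' l y).
  by apply: filter_forall => k; apply: filter_forall => l; case: (tP k l).
near=> y => u v; have fy : frame_at e co y by near: y.
have fy' : frame_at e' co' y by near: y.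
have [lG lG' _] : [/\ forall v, linear_fun (fun u => G y u v),
    forall u, linear_fun (G y u) &
    forall s t, vreg s y -> vreg t y -> vreg (fun z => G z (s z) (t z)) y].
  by near: y.
rewrite (linear_fun_sum _ _ _ (@lin_linear y i)) [in RHS](frame_id fy u).
rewrite (linear_fun_sum _ _ _ (lG v)); apply: eq_bigr => k _; congr (_ *: _).
rewrite (linear_fun_sum _ _ _ (@lin_linear y i)) [in RHS](frame_id fy' v).
rewrite (linear_fun_sum _ _ _ (lG' _)); apply: eq_bigr => l _; congr (_ *: _).
by move: k l; near: y.
Unshelve. all: by end_near. Qed.

End Lifting.

(** * Chain maps over the foliation *)

Section ChainMaps.
Context {R : realType} {c : geometry} {n : nat} {M : manifold R c n}.
Local Notation K := (scalars R c).
Implicit Types (x y : M) (E F G : lie_infty_algebroid M).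

Record chain_map E F (f : forall i y, fib (E i) y -> fib (F i) y) x : Prop :=
  ChainMap {
    chain_bundle_map : forall i, bundle_map (f i) x;
    chain_lin : forall i, \forall y \near x, forall v,
      lin F i y (f i.+1 y v) = f i y (lin E i y v);
    chain_rho : \forall y \near x, forall (v : fib (E 0) y) g, reg g y ->
      rho (f 0 y v) g = rho v g }.

Lemma chain_map_id E x : chain_map (fun i y (v : fib (E i) y) => v) x.
Proof. by split=> [i|i|]; exact: nearW. Qed.

Lemma chain_map_comp E F G (f : forall i y, fib (E i) y -> fib (F i) y)
    (g : forall i y, fib (F i) y -> fib (G i) y) x :
  chain_map f x -> chain_map g x -> chain_map (fun i y v => g i y (f i y v)) x.
Proof.
move=> [bf lf rf] [bg lg rg]; split=> [i|i|].
- exact: bundle_map_comp.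
- by apply: filterS2 (lf i) (lg i) => y lfy lgy v; rewrite lgy lfy.
- by apply: filterS2 rf rg => y rfy rgy v h hy; rewrite rgy// rfy.
Qed.

Section ChainMapAt.
Variables (E F : lie_infty_algebroid M) (f : forall i y, fib (E i) y ->
  fib (F i) y).
Arguments f : clear implicits.
Variable x : M.
Hypothesis cf : chain_map f x.

Lemma chain_map_linear i : linear_fun (f i x).
Proof. by have [] := nbhs_singleton (chain_bundle_map cf i). Qed.

Lemma chain_map_cocycle i u : u \in cocycle E x i -> f i x u \in cocycle F x i.
Proof.
case: i u => [|i] u.
  by move=> /cocycle0P u0; apply/cocycle0P => g rg;
    rewrite (nbhs_singleton (chain_rho cf))// u0.
move=> /cocycleSP u0; apply/cocycleSP.
by rewrite (nbhs_singleton (chain_lin cf i)) u0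
  (linear_fun0 (@chain_map_linear i)).
Qed.

Lemma coboundaryP E' i (u : fib (E' i) x) :
  u \in coboundary E' x i <-> exists t, u = lin E' i x t.
Proof. by rewrite inE. Qed.

Lemma chain_map_coboundary i u : u \in coboundary E x i ->
  f i x u \in coboundary F x i.
Proof.
move=> /coboundaryP[t ->]; apply/coboundaryP; exists (f i.+1 x t).
by rewrite (nbhs_singleton (chain_lin cf i)).
Qed.

End ChainMapAt.

Lemma chain_homotopy D E F (f g : forall i y, fib (E i) y -> fib (F i) y) x i u
  :
  universal_resolving F D -> chain_map f x -> chain_map g x ->
  u \in cocycle E x i -> f i x u - g i x u \in coboundary F x i.
Proof.
move=> uF cf cg.
(* The second clause makes the remainder f - g - H d of the next index a cocycle near x, so that it
   can be lifted in turn; the third is the claim at x. *)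
pose S j := exists (H : forall y, fib (E j) y -> fib (F j.+1) y),
  [/\ bundle_map H x,
    \forall y \near x, forall u : fib (E j.+1) y,
      lin F j y (f j.+1 y u - g j.+1 y u - H y (lin E j y u)) = 0 &
    forall u, u \in cocycle E x j -> f j x u - g j x u \in coboundary F x j].
suff: S i by case=> H [_ _]; apply.
elim: i {u} => [|i [H [bH nH _]]].
  (* In index 0 both maps commute with the anchors, so f - g is a boundary on all of E_{-1}, with no
     term H d. *)
  have [||H bH HE] := lift_bundle_map uF (x := x)
    (G := fun y u => f 0 y u - g 0 y u).
  - by apply: bundle_mapB; exact: chain_bundle_map.
  - apply: filterS2 (chain_rho cf) (chain_rho cg) => y rf rg v; apply/cocycle0P.
    move=> h rh; rewrite addrC -scaleN1r rho_lin// rf// rg// mulN1r.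
    exact: addNr.
  exists H; split=> //.
  - apply: filterS3 HE (chain_lin cf 0) (chain_lin cg 0) => y HE lf lg v.
    by rewrite linearB linearB /= HE lf lg subrr.
  - move=> v _; apply/coboundaryP; exists (H x v).
    by rewrite (nbhs_singleton HE).
have bHd : bundle_map (fun y u => H y (lin E i y u)) x.
  by apply: bundle_map_comp bH; exact: lin_bundle_map.
have [||H' bH' HE] := lift_bundle_map uF (x := x)
  (G := fun y u => f i.+1 y u - g i.+1 y u - H y (lin E i y u)).
- by apply: bundle_mapB => //; apply: bundle_mapB; exact: chain_bundle_map.
- by apply: filterS nH => y nH v; apply/cocycleSP.
exists H'; split=> //.
- have nH0 : \forall y \near x, H y 0 = 0.
    by apply: filterS bH => y [/linear_fun0].
  near=> y => v; rewrite linearB linearB /=.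
  have -> : lin F i.+1 y (f i.+2 y v) = f i.+1 y (lin E i.+1 y v).
    by move: v; near: y; exact: chain_lin.
  have -> : lin F i.+1 y (g i.+2 y v) = g i.+1 y (lin E i.+1 y v).
    by move: v; near: y; exact: chain_lin.
  have -> : lin F i.+1 y (H' y (lin E i.+1 y v)) = f i.+1 y (lin E i.+1 y v) -
      g i.+1 y (lin E i.+1 y v) - H y (lin E i y (lin E i.+1 y v)).
    by move: (lin E i.+1 y v); near: y.
  rewrite lin_lin (_ : H y 0 = 0) ?subr0 ?subrr//.
  by near: y.
- move=> v /cocycleSP v0; apply/coboundaryP; exists (H' x v).
  rewrite (nbhs_singleton HE) v0 linear_fun0 ?subr0//.
  by have [] := nbhs_singleton bH.
Unshelve. all: by end_near. Qed.

Lemma chain_map_exists D E F x :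
  universal_resolving E D -> universal_resolving F D ->
  exists f : forall i y, fib (E i) y -> fib (F i) y, chain_map f x.
Proof.
move=> uE uF.
(* The second clause is what allows f d to be lifted in the next index. *)
pose good i (f : forall y, fib (E i) y -> fib (F i) y) := bundle_map f x /\
  \forall y \near x, forall v : fib (E i.+1) y,
    f y (lin E i y v) \in cocycle F y i.
have [f0 [good0 rho0]] : exists f : forall y, fib (E 0) y -> fib (F 0) y,
    good 0%N f /\ \forall y \near x, forall (v : fib (E 0) y) g, reg g y ->
      rho (f y v) g = rho v g.
  have [r [e [co nf]]] := local_frame (E 0) x.
  (* The anchors of a frame of E lie in D, hence are anchors of sections of F. *)
  have [t tP] : exists t : 'I_r -> forall y, fib (F 0) y, forall k,
      vreg (t k) x /\ vf_eq (anchor (E := F) (t k)) (anchor (E := E) (e k)) x.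
    apply: (fin_all_exists (P := fun k (t : forall y, fib (F 0) y) =>
      vreg t x /\ vf_eq (anchor (E := F) t) (anchor (E := E) (e k)) x)) => k.
    have : D (anchor (E := E) (e k)) x.
      case: uE => DE _ _; apply/DE; exists (e k).
        exact: frame_sec (nbhs_singleton nf) k.
      by apply: nearW.
    by case: uF => DF _ _ /DF[t rt tE]; exists t.
  have nt : \forall y \near x, forall k g, reg g y ->
    rho (t k y) g = rho (e k y) g.
    by apply: filter_forall => k; case: (tP k).
  have bf : bundle_map (fun y v => \sum_k co k y v *: t k y) x.
    by apply: frame_map nf _ => k; case: (tP k).
  have frho : \forall y \near x, forall (v : fib (E 0) y) g, reg g y ->
      rho (\sum_k co k y v *: t k y) g = rho v g.
    apply: filterS2 nf nt => y fy ty v g rg.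
    have lF : linear_fun (fun w : fib (F 0) y => rho w g : K^o).
      by move=> a u w; rewrite rho_lin.
    have lE : linear_fun (fun w : fib (E 0) y => rho w g : K^o).
      by move=> a u w; rewrite rho_lin.
    rewrite [in RHS](frame_id fy v).
    rewrite (linear_fun_sum _ _ _ lF) (linear_fun_sum _ _ _ lE).
    by apply: eq_bigr => k _; rewrite ty.
  exists (fun y v => \sum_k co k y v *: t k y); split=> //; split=> //.
  apply: filterS frho => y fy v; apply/cocycle0P => g rg.
  by rewrite fy// rho_lin0.
(* Each map depends on the previous one; with sigma types the recursion [F'] carries out this
   dependent choice. *)
have step i (f : {f | good i f}) : {f' | good i.+1 f' /\
    \forall y \near x, forall v, lin F i y (f' y v) = sval f y (lin E i y v)}.
  apply: cid; case: f => f [bf cf] /=.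
  have [||f' bf' lf'] := lift_bundle_map uF (x := x)
    (G := fun y u => f y (lin E i y u)).
  - by apply: bundle_map_comp bf; exact: lin_bundle_map.
  - exact: cf.
  exists f'; split=> //; split=> //.
  have nf0 : \forall y \near x, f y 0 = 0.
    by apply: filterS bf => y [/linear_fun0].
  apply: filterS2 lf' nf0 => y lf' f0' v.
  by apply/cocycleSP; rewrite lf' lin_lin f0'.
pose F' := fix F' i : {f | good i f} :=
  if i is j.+1 then exist _ (sval (step j (F' j)))
    (proj1 (svalP (step j (F' j))))
  else exist _ f0 good0.
exists (fun i => sval (F' i)); split.
- by move=> i; case: (svalP (F' i)).
- by move=> i; apply: (proj2 (svalP (step i (F' i)))).
- exact: rho0.
Qed.

End ChainMaps.

(** * The defect of a chain map *)

Section Pullback.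
Context {R : realType} {c : geometry} {n : nat} {M : manifold R c n}.
Local Notation K := (scalars R c).
Variables (E F : lie_infty_algebroid M).
Variable f : forall i y, fib (E i) y -> fib (F i) y.
Arguments f : clear implicits.
Implicit Types (x y : M) (xi eta al : gfun F).

(* The neighbourhood of x on which f_i is a chain map may shrink as i grows; in
   bounded degree the conditions are open. *)
Record chain_upto p y : Prop := ChainUpto {
  upto_map : forall i, (i < p)%N -> bundle_map (f i) y;
  upto_lin : forall i, (i.+1 < p)%N -> \forall z \near y, forall v,
    lin F i z (f i.+1 z v) = f i z (lin E i z v);
  upto_rho : \forall z \near y, forall (v : fib (E 0) z) g, reg g z ->
    rho (f 0 z v) g = rho v g }.

Lemma chain_map_upto p x : chain_map f x -> chain_upto p x.
Proof. by move=> [bf lf rf]; split=> // i _. Qed.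

Lemma chain_upto_near p y : chain_upto p y -> \forall z \near y, chain_upto p z.
Proof.
move=> [bf lf rf].
have nb : \forall z \near y, forall i : 'I_p, bundle_map (f i) z.
  by apply: filter_forall => i; apply: near_join; exact: bf.
have nl : \forall z \near y, forall i : 'I_p, (i.+1 < p)%N -> \forall z \near z,
    forall v, lin F i z (f i.+1 z v) = f i z (lin E i z v).
  apply: filter_forall => i; have [ip|ip] := boolP (i.+1 < p)%N.
    by apply: filterS (near_join (lf _ ip)).
  exact: nearW.
apply: filterS3 nb nl (near_join rf) => z bz lz rz; split=> // i ip.
  exact: (bz (Ordinal ip)).
exact: (lz (Ordinal (ltnW ip))).
Qed.

Definition push y (h : hvec E y) : hvec F y := hv (f (tag h) y (tagged h)).

Definition pull xi : gfun E := fun y l => xi y [seq push h | h <- l].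
Arguments pull xi x l : clear implicits, rename.

Lemma fmul_push p y (X Y : seq (hvec F y) -> K) l :
  fmul p X Y [seq push h | h <- l]
  = fmul p (fun s => X [seq push h | h <- s]) (fun s => Y [seq push h | h <- s])
    l.
Proof. by elim: l p X Y => //= h l IH p X Y; rewrite !IH. Qed.

Lemma pull_gmul p xi eta : pull (gmul p xi eta) = gmul p (pull xi) (pull eta).
Proof.
by apply: functional_extensionality_dep => y; apply/funext => l;
  apply: fmul_push.
Qed.

(** Index i has degree i.+1, so a function of degree at most p vanishes once an argument has index p
    or more: only the f_i with i < p matter. *)
Lemma pull_gf p k xi y : chain_upto p y -> (k <= p)%N -> gf k xi y ->
  gf k (pull xi) y.
Proof.
move=> cy kp gx; apply/gfP.
have ngx := gf_near gx.
apply: filterS2 (chain_upto_near cy) (near_near_and ngx) => z cz [gz ngz].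
have [mx sx dx rx] := gf_at gz.
have x0 s : has (fun h => p <= tag h)%N s -> xi z s = 0.
  move=> /has_tag_degree ps; apply: dx.
  by rewrite neq_ltn (leq_ltn_trans kp ps) orbT.
split.
- move=> s t i a u v; rewrite /pull !map_cat /=.
  have [ip|pi] := ltnP i p; last by rewrite !x0 ?mulr0 ?addr0// has_cat /= pi
    orbT.
  have [lf _] := nbhs_singleton (upto_map cz ip).
  by rewrite -mx -lf.
- by move=> s t u v; rewrite /pull !map_cat /= sx.
- by move=> s ds; apply: dx; rewrite big_map.
- move=> L Lz; have [hL|hL] := boolP (has (fun s => p <= tag s)%N L).
    apply: (@reg_germ _ _ _ _ (fun=> 0)); first exact: reg_cst.
    apply: filterS ngz => w /gf_at[_ _ dw _].
    rewrite /pull dw// neq_ltn (leq_ltn_trans kp) ?orbT//.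
    by apply: has_tag_degree; rewrite -map_comp has_map.
  pose fs (s : hsec E) : hsec F :=
    existT _ (tag s) (fun z => f (tag s) z (tagged s z)).
  have Lz' : all_vreg (map fs L) z.
    elim: L Lz hL => //= s L IH [rs Ls]; rewrite negb_or -ltnNge =>
      /andP[sp hL].
    split; last exact: IH.
    by have [_] := nbhs_singleton (upto_map cz sp); apply.
  apply: reg_germ (rx _ Lz') _.
  by apply: nearW => w; rewrite /pull -!map_comp.
Qed.

Lemma pull_covector p k al y : chain_upto p y -> (k < p)%N -> covector k al y ->
  covector k (pull al) y.
Proof.
move=> cy kp cal; split; first exact: pull_gf cy kp cal.1.
by apply: filterS cal.2 => z az s s1; apply: az; rewrite size_map.
Qed.

(* the failure of the bundle map f to intertwine the homological vector fields
  *)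
Definition defect xi : gfun E :=
  gf_lin (fun=> -1) (Q E (pull xi)) (pull (Q F xi)).
Arguments defect xi x l : clear implicits, rename.

Lemma defectE xi y l :
  defect xi y l = Q F xi y [seq push h | h <- l] - Q E (pull xi) y l.
Proof. by rewrite /defect /gf_lin mulN1r addrC. Qed.

Lemma defect_gf p k xi y : chain_upto p y -> (k < p)%N -> gf k xi y ->
  gf k.+1 (defect xi) y.
Proof.
move=> cy kp gx; apply: gf_gf_lin; first exact: reg_cst.
  by apply: Q_deg; apply: pull_gf cy (ltnW kp) gx.
by apply: pull_gf cy kp _; apply: Q_deg.
Qed.

Lemma gf_reg0 k xi y : gf k xi y -> reg (fun z => xi z [::]) y.
Proof. by case/gf_at => _ _ _ rx; apply: (rx [::]). Qed.

(** Arity 1 involves only the anchor and the differential, with which f commutes. *)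
Lemma defect1 p k xi y i (v : fib (E i) y) : chain_upto p y -> (k < p)%N ->
  gf k xi y -> defect xi y [:: hv v] = 0.
Proof.
move=> cy kp gx; have [ki|ki] := eqVneq k i; last first.
  by have [_ _ d _] := gf_at (defect_gf cy kp gx); rewrite (form_degree1 _ d).
subst i; rewrite defectE /= -/(hv _) (Q1 _ gx) (Q1 _ (pull_gf cy (ltnW kp) gx)).
have -> : rho (f k y v) (fun z => xi z [::]) =
    rho v (fun z => pull xi z [::]).
  have rx := gf_reg0 gx.
  case: k v {gx} kp => [|k] v kp; last by rewrite !rho_pos.
  by rewrite (nbhs_singleton (upto_rho cy)).
rewrite opprD addrACA subrr addr0; apply/eqP; rewrite subr_eq0; apply/eqP.
case: k v kp {gx} => [|k] v kp //=.
by rewrite (nbhs_singleton (upto_lin cy kp)).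
Qed.

Lemma defect_ge2 p k xi y : chain_upto p y -> (k < p)%N -> gf k xi y ->
  gf_ge 2 k.+1 (defect xi) y.
Proof.
move=> cy kp gx; split; first exact: defect_gf cy kp gx.
apply: filterS2 (chain_upto_near cy) (gf_near gx) => z cz gz [|[i v] []]// _.
  exact: gf_nil (defect_gf cz kp gz).
exact: (defect1 (i := i) _ cz kp gz).
Qed.

(** The defect is a derivation along the pullback with values of arity at least 2, so al times the
    defect of eta starts in arity 3. No derivative of eta survives, whence O-linearity. *)
Lemma defect_gmul p q s al eta y i j (u : fib (E i) y) (v : fib (E j) y) :
  chain_upto p y -> (q.+1 + s < p)%N -> covector q al y -> gf s eta y ->
  defect (gmul q.+1 al eta) y [:: hv u; hv v]
  = defect al y [:: hv u; hv v] * eta y [::].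
Proof.
move=> cy qsp cal ge.
have sp : (s < p)%N by lia.
have qp : (q.+1 < p)%N by lia.
have cpal := pull_covector cy (ltnW qp) cal.
have gpe := pull_gf cy (ltnW sp) ge.
have dE k (w : fib (E k) y) : Q F eta y [:: hv (f k y w)] = Q E (pull eta) y
  [:: hv w].
  by apply/eqP; rewrite -subr_eq0 -(defect1 w cy sp ge) defectE.
have dA k (w : fib (E k) y) : Q F al y [:: hv (f k y w)] = Q E (pull al) y
  [:: hv w].
  by apply/eqP; rewrite -subr_eq0 -(defect1 w cy qp cal.1) defectE.
rewrite !defectE pull_gmul (Q_der (l := F) cal.1 ge)
  (Q_der (l := E) cpal.1 gpe).
rewrite /gf_lin /gmul /= -/(push (hv u)) /push /=.
rewrite (covector_nil cal) (covector_nil cpal) (gf_nil (Q_deg (l := F) cal.1)).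
rewrite (gf_nil (Q_deg (l := E) cpal.1)) !dE !dA {2 4 6 8 10 12}/pull /=.
rewrite (covector_arity1 cal (s := [:: _; _]))//
  (covector_arity1 cpal (s := [:: _; _]))//.
by rewrite /pull /push /=; ring.
Qed.

Lemma defect_Q p k xi y l : chain_upto p y -> (k.+1 < p)%N -> gf k xi y ->
  defect (Q F xi) y l = - Q E (defect xi) y l.
Proof.
move=> cy kp gx; rewrite defectE (QQ _ gx) sub0r; congr (- _).
have gp := pull_gf cy (ltnW (ltnW kp)) gx.
rewrite /defect (Q_lin (l := E) (-1) (Q_deg (l := E) gp)).
  by rewrite /gf_lin (QQ _ gp) mulr0 add0r.
by apply: pull_gf cy (ltnW kp) _; apply: Q_deg.
Qed.

End Pullback.
Arguments pull {R c n M E F} f xi x l : rename.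
Arguments defect {R c n M E F} f xi x l : rename.

(** * The bilinear map carried by the defect, and its null-homotopy *)

Section DefectBracket.
Context {R : realType} {c : geometry} {n : nat} {M : manifold R c n}.
Local Notation K := (scalars R c).
Variables (E F : lie_infty_algebroid M).
Variable f : forall i y, fib (E i) y -> fib (F i) y.
Arguments f : clear implicits.
Variables (r : nat -> nat) (e : forall i, 'I_(r i) -> forall y, fib (F i) y).
Variable (co : forall i, 'I_(r i) -> forall y, fib (F i) y -> K).
Arguments e : clear implicits.
Arguments co : clear implicits.
Implicit Types (x y : M) (xi eta al : gfun F).

(* up to sign f{u, v} - {f u, f v}, in which the anchor terms cancel *)
Definition defect_bracket k i j y (u : fib (E i) y) (v : fib (E j) y) :
    fib (F k) y :=
  \sum_l defect f (dual_gfun (co k l)) y [:: hv u; hv v] *: e k l y.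
Arguments defect_bracket : clear implicits.

(** The bound p makes the condition open in y ([adapted_near]). *)
Definition adapted p y := chain_upto f p y /\
  forall k, (k < p)%N -> \forall z \near y, frame_at (e k) (co k) z.

Lemma adapted_near p y : adapted p y -> \forall z \near y, adapted p z.
Proof.
move=> [cy fy].
have nf : \forall z \near y, forall k : 'I_p, \forall z \near z,
    frame_at (e k) (co k) z.
  by apply: filter_forall => k; apply: near_join; exact: fy.
apply: filterS2 (chain_upto_near cy) nf => z cz fz; split=> // k kp.
exact: (fz (Ordinal kp)).
Qed.

Lemma adapted_at p y k : adapted p y -> (k < p)%N -> frame_at (e k) (co k) y.
Proof. by move=> [_ fy] /fy/nbhs_singleton. Qed.

Lemma adapted_dual p y k l : adapted p y -> (k < p)%N ->
  covector k (dual_gfun (co k l)) y.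
Proof. by move=> [_ fy] /fy; apply: dual_frame_covector. Qed.

Lemma pull_germ xi eta y :
  (\forall z \near y, gf_eq_at xi eta z) ->
  \forall z \near y, gf_eq_at (pull f xi) (pull f eta) z.
Proof. by apply: filterS => z xe s; apply: xe. Qed.

(** [defect_gmul] reduces the claim to coframe elements. It is stated beyond covectors because it is
    later applied to Q of a covector, which has components of higher arity. *)
Lemma defect_bracketP k xi y i j (u : fib (E i) y) (v : fib (E j) y) :
  adapted k.+2 y -> gf k.+1 xi y ->
  defect f xi y [:: hv u; hv v] = xi y [:: hv (defect_bracket k i j y u v)].
Proof.
move=> gy /(gf_ge1 (k := k.+1) isT); move: xi.
have cy := gy.1.
apply: (gf_frame_ind (e := e) (co := co)).
- by move=> q qk; apply: gy.2; exact: ltnW.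
- move=> xi eta gx ge nxe; have /gf_eqP xe := nbhs_singleton nxe.
  rewrite -xe => <-; rewrite !defectE (Q_germ (l := F) gx ge nxe);
    congr (_ - _).
  apply/esym/(Q_germ (l := E) (pull_gf cy _ gx) (pull_gf cy _ ge)) => //.
  exact: pull_germ nxe.
- rewrite defectE (Q_eq0 (gf0 F 0 y)); last by apply: nearW => z [].
  rewrite (Q_eq0 (pull_gf cy (leq0n _) (gf0 F 0 y))) ?subrr//.
  by apply: nearW => z [].
- move=> xi eta gx ge Px Pe.
  have gpx := pull_gf cy (leqnSn _) gx; have gpe := pull_gf cy (leqnSn _) ge.
  rewrite [RHS]/gf_lin -Px -Pe !defectE (Q_lin (l := F) 1 gx ge).
  rewrite (_ : pull f _ = gf_lin (fun=> 1) (pull f xi) (pull f eta))//.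
  by rewrite (Q_lin (l := E) 1 gpx gpe) /gf_lin; ring.
- move=> q s l eta pqs [ge _]; have qk : (q < k.+1)%N by lia.
  have cal := adapted_dual l gy (ltnW qk).
  rewrite (defect_gmul _ _ cy _ cal ge); last by lia.
  rewrite /gmul (fmul1 _ _ _ (covector_nil cal)).
  case: s pqs ge => [|s] pqs ge; last by rewrite (gf_nil ge) !mulr0.
  move: pqs; rewrite addn0 => -[kq]; subst q; congr (_ * _).
  rewrite {2}/dual_gfun dual_form1 /defect_bracket.
  by rewrite (frame_coord _ _ (adapted_at gy (ltnW qk))).
Qed.

Lemma defect_bracket_linl k i j y (v : fib (E j) y) : adapted k.+2 y ->
  linear_fun (fun u => defect_bracket k i j y u v).
Proof.
move=> gy a u u'; apply: covector_sep => al cal.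
have [mal _ _ _] := gf_at cal.1.
rewrite (mal [::] [::]) /= -!(defect_bracketP _ _ gy cal.1).
have [md _ _ _] := gf_at (defect_gf gy.1 (leqnn _) cal.1).
exact: (md [::] [:: hv v]).
Qed.

Lemma defect_bracket_linr k i j y (u : fib (E i) y) : adapted k.+2 y ->
  linear_fun (defect_bracket k i j y u).
Proof.
move=> gy a v v'; apply: covector_sep => al cal.
have [mal _ _ _] := gf_at cal.1.
rewrite (mal [::] [::]) /= -!(defect_bracketP _ _ gy cal.1).
have [md _ _ _] := gf_at (defect_gf gy.1 (leqnn _) cal.1).
exact: (md [:: hv u] [::]).
Qed.

Lemma defect_bracket_bilinear k i j x : adapted k.+2 x ->
  bilinear_map (defect_bracket k i j) x.
Proof.
move=> gx; apply: filterS (adapted_near gx) => y gy; split=> [v|u|s t rs rt].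
- exact: defect_bracket_linl.
- exact: defect_bracket_linr.
- apply: (@vreg_sum _ _ _ _ _ _ _ (fun l z =>
    defect f (dual_gfun (co k l)) z [:: hv (s z); hv (t z)]) (fun l => e k l))
      => l.
    have cal := adapted_dual l gy (leqnSn _).
    have [_ _ _ rd] := gf_at (defect_gf gy.1 (leqnn _) cal.1).
    exact: (rd [:: existT _ i s; existT _ j t]).
  exact: frame_sec (adapted_at gy (leqnSn _)) l.
Qed.

(** T Q_F = - Q_E T on a covector, read in arity 2. A free target index with an equation on i + j
    avoids transports between fibers. *)
Lemma lin_defect_bracket k i j y (u : fib (E i) y) (v : fib (E j) y) :
  (i + j)%N = k.+1 -> adapted k.+3 y ->
  lin F k y (defect_bracket k.+1 i j y u v)
  = (-1) ^+ j.+1 *: lin_precomp (W := fib (F k) y)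
    (fun i' u' => defect_bracket k i' j y u' v) u
    + lin_precomp (W := fib (F k) y) (fun j' v' => defect_bracket k i j' y u v')
        v.
Proof.
move=> ijk gy; have gy' : adapted k.+2 y.
  case: gy => -[bf lf rf] fy; split; last by move=> q qk; apply: fy;
    exact: ltnW.
  by split=> // q qk; [apply: bf|apply: lf]; exact: ltnW.
apply: covector_sep => al cal; have [mal _ _ _] := gf_at cal.1.
have cQ := Q_covector1 (defect_bracket k.+1 i j y u v) cal.
have gQ := Q_deg (l := F) cal.1.
have := defect_bracketP u v gy gQ.
rewrite cQ (defect_Q _ gy.1 _ cal.1)// (Q_ge2 u v
  (defect_ge2 gy'.1 (leqnn _) cal.1)).
rewrite (mal [::] [::]) /=.
have -> : lin_precomp (fun k0 w => defect f al y [:: hv w; hv v]) u =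
    al y [:: hv (lin_precomp (W := fib (F k) y)
      (fun i' u' => defect_bracket k i' j y u' v) u)].
  case: (i) (u) => [|i'] u' /=; last by rewrite (defect_bracketP _ _ gy' cal.1).
  by rewrite (multilinear_form0 [::] [::] _ mal).
have -> : lin_precomp (fun k0 w => defect f al y [:: hv u; hv w]) v =
    al y [:: hv (lin_precomp (W := fib (F k) y)
      (fun j' v' => defect_bracket k i j' y u v') v)].
  case: (j) (v) => [|j'] v' /=; last by rewrite (defect_bracketP _ _ gy' cal.1).
  by rewrite (multilinear_form0 [::] [::] _ mal).
move: (al y _) (al y _) (al y _) => d b a; rewrite ijk => eqd.
have sgE m : (-1 : K) ^+ m = if odd m then -1 else 1.
  by rewrite -signr_odd; case: odd.
have ki : odd k = ~~ (odd i (+) odd j).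
  by rewrite -oddD ijk /= negbK.
rewrite -[d](signrMK k.+1) -eqd !sgE /= !negbK ki.
by case: (odd i); case: (odd j) => /=; ring.
Qed.


(** The defect of a function has degree 1 and arity at least 2, hence is zero; T Q_F = - Q_E T then
    gives a null anchor. *)
Lemma defect_bracket_null y (u v : fib (E 0) y) : adapted 2 y ->
  null_anchor (defect_bracket 0 0 0 y u v).
Proof.
move=> gy g rg; have gg := gf_gf_of_fun F rg.
rewrite /rho -(defect_bracketP _ _ gy (Q_deg (l := F) gg))
  (defect_Q _ gy.1 _ gg)//.
have [gd d0] := defect_ge2 gy.1 (isT : 0 < 2)%N gg.
rewrite (Q_eq0 gd) ?oppr0//; apply: filterS2 d0 (gf_near gd) =>
  z d0 /gf_at[_ _ dz _] l.
case: l => [|h [|h' l]]; [exact: d0|exact: d0|apply: dz].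
by rewrite !big_cons /hdeg; lia.
Qed.

(** Precomposition with the differential of the tensor square of E, with the signs of
    [lin_defect_bracket]. *)
Definition boundary N (H : forall i j y, fib (E i) y -> fib (E j) y ->
  fib (F N) y)
    i j y (u : fib (E i) y) (v : fib (E j) y) : fib (F N) y :=
  (-1) ^+ j.+1 *: lin_precomp (W := fib (F N) y) (fun i' u' => H i' j y u' v) u
  + lin_precomp (W := fib (F N) y) (fun j' v' => H i j' y u v') v.
Arguments boundary {N} H i j y u v.

Lemma boundary_bilinear N H x : (forall i j, bilinear_map (H i j) x) ->
  forall i j, bilinear_map (@boundary N H i j) x.
Proof.
move=> bH i j; apply: bilinear_map_lin.
  case: i => [|i]; first exact: bilinear_map0.
  by apply: bilinear_map_compl (bH i j); apply: lin_bundle_map.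
case: j => [|j]; first exact: bilinear_map0.
by apply: bilinear_map_compr (bH i j); apply: lin_bundle_map.
Qed.

(** The mixed terms cancel since applying the differential to v flips the sign (-1)^{j+1}; the
    others contain two consecutive differentials. Asking for vanishing at 0 only up to i and j
    leaves finitely many conditions to hold near x. *)
Lemma boundary_boundary N (H : forall i j y, fib (E i) y -> fib (E j) y ->
  fib (F N) y)
    i j y (u : fib (E i) y) (v : fib (E j) y) :
  (forall i' j', (i' <= i)%N -> (j' <= j)%N ->
    (forall v, H i' j' y 0 v = 0) /\ (forall u, H i' j' y u 0 = 0)) ->
  boundary (boundary H) i j y u v = 0.
Proof.
move=> H0; rewrite /boundary.
have Hl i' j' v' : (i' <= i)%N -> (j' <= j)%N -> H i' j' y 0 v' = 0.
  by move=> ii jj; have [-> _] := H0 _ _ ii jj.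
have Hr i' j' u' : (i' <= i)%N -> (j' <= j)%N -> H i' j' y u' 0 = 0.
  by move=> ii jj; have [_ ->] := H0 _ _ ii jj.
case: i j u v Hl Hr {H0} => [|i] [|j] u v Hl Hr /=.
- by rewrite scaler0 addr0.
- rewrite !scaler0 !add0r; case: j v Hl Hr => //= j v Hl Hr.
  by rewrite lin_lin Hr//; lia.
- rewrite !addr0; case: i u Hl Hr => [|i] u Hl Hr /=; first by rewrite !scaler0.
  by rewrite lin_lin Hl ?scaler0//; lia.
- have -> : lin_precomp (W := fib (F N) y) (fun i' u' => H i' j.+1 y u' v)
      (lin E i y u) = 0.
    by case: i u Hl Hr => [|i] u Hl Hr //=; rewrite lin_lin Hl//; lia.
  have -> : lin_precomp (W := fib (F N) y) (fun j' v' => H i.+1 j' y u v')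
      (lin E j y v) = 0.
    by case: j v Hl Hr => [|j] v Hl Hr //=; rewrite lin_lin Hr//; lia.
  by rewrite scaler0 add0r addr0 -scalerDl exprS mulN1r addNr scale0r.
Qed.

Section Homotopy.
Variables (D : vfop M -> M -> Prop) (x : M).
Hypothesis uF : universal_resolving F D.
Hypothesis gx : forall p, adapted p x.

Lemma defect_bracket_lift N (H : forall i j y, fib (E i) y -> fib (E j) y ->
  fib (F N) y)
    i j : (forall i j, bilinear_map (H i j) x) ->
  (\forall y \near x, forall u v,
    defect_bracket N i j y u v - boundary H i j y u v \in cocycle F y N) ->
  exists2 H', bilinear_map H' x & \forall y \near x, forall u v,
    lin F N y (H' y u v) = defect_bracket N i j y u v - boundary H i j y u v.
Proof.
move=> bH cH.
have bG := bilinear_map_lin (-1) (boundary_bilinear bH i j)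
  (defect_bracket_bilinear i j (gx N.+2)).
have [|H' bH' lH'] := lift_bilinear_map uF bG.
  by apply: filterS cH => y cH u v; rewrite scaleN1r addrC.
by exists H' => //; apply: filterS lH' => y lH' u v; rewrite lH' scaleN1r addrC.
Qed.

(** For given N, H matters on total index N - 1. Lifting the remainder gives the homotopy on total
    index N, and the next remainder is a cocycle because [boundary] squares to zero. *)
Lemma defect_homotopy N :
  exists H : forall i j y, fib (E i) y -> fib (E j) y -> fib (F N) y,
    (forall i j, bilinear_map (H i j) x) /\
    forall i j, (i + j)%N = N -> \forall y \near x, forall u v,
      defect_bracket N i j y u v - boundary H i j y u v \in cocycle F y N.
Proof.
elim: N => [|N [H [bH cH]]].
  (* No pair has total index -1, so H = 0 serves. *)
  exists (fun _ _ _ _ _ => 0); split=> [i j|i j]; first exact: bilinear_map0.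
  case: i j => [|//] [|//] _.
  apply: filterS (adapted_near (gx 2)) => y gy u v.
  by rewrite /boundary /= scaler0 addr0 subr0;
    apply/cocycle0P/defect_bracket_null.
have step i j : {H' : forall y, fib (E i) y -> fib (E j) y -> fib (F N.+1) y |
    bilinear_map H' x /\ ((i + j)%N = N -> \forall y \near x, forall u v,
    lin F N y (H' y u v) = defect_bracket N i j y u v - boundary H i j y u v)}.
  apply: cid; have [ijN|ijN] := eqVneq (i + j)%N N; last first.
    (* Filler outside i + j = N, so that H' is a family over all pairs. *)
    exists (fun _ _ _ => 0); split; first exact: bilinear_map0.
    by move=> ijN'; rewrite ijN' eqxx in ijN.
  by have [H' bH' lH'] := defect_bracket_lift bH (cH i j ijN); exists H'.
pose H' i j := sval (step i j).
have bH' i j : bilinear_map (H' i j) x by have [] := svalP (step i j).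
exists H'; split=> // i j ijN.
have lu : \forall y \near x, forall (u : fib (E i) y) (v : fib (E j) y),
    lin F N y (lin_precomp (W := fib (F N.+1) y) (fun i' u' => H' i' j y u' v)
      u) =
    lin_precomp (W := fib (F N) y) (fun i' u' => defect_bracket N i' j y u' v) u
    - lin_precomp (W := fib (F N) y) (fun i' u' => boundary H i' j y u' v) u.
  case: i ijN => [|i] ijN; first by apply: nearW => y u v;
    rewrite /= linear0 subr0.
  have [_ /(_ (succn_inj ijN))] := svalP (step i j).
  by apply: filterS => y lH u v; apply: lH.
have lv : \forall y \near x, forall (u : fib (E i) y) (v : fib (E j) y),
    lin F N y (lin_precomp (W := fib (F N.+1) y) (fun j' v' => H' i j' y u v')
      v) =
    lin_precomp (W := fib (F N) y) (fun j' v' => defect_bracket N i j' y u v') v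
    - lin_precomp (W := fib (F N) y) (fun j' v' => boundary H i j' y u v') v.
  case: j ijN {lu} => [|j] ijN; first by apply: nearW => y u v;
    rewrite /= linear0 subr0.
  rewrite addnS in ijN; have [_ /(_ (succn_inj ijN))] := svalP (step i j).
  by apply: filterS => y lH u v; apply: lH.
have nH0 : \forall y \near x, forall (i' : 'I_i.+1) (j' : 'I_j.+1),
    (forall v, H i' j' y 0 v = 0) /\ (forall u, H i' j' y u 0 = 0).
  apply: filter_forall => i'; apply: filter_forall => j'.
  apply: filterS (bH i' j') => y [Hl Hr _]; split=> w.
    exact: (linear_fun0 (Hl w)).
  exact: (linear_fun0 (Hr w)).
near=> y => u v; apply/cocycleSP.
rewrite linearB /= lin_defect_bracket//; last by near: y; exact: adapted_near.
rewrite {1}/boundary linearD linearZ /=.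
have -> : lin F N y (lin_precomp (W := fib (F N.+1) y)
  (fun i' u' => H' i' j y u' v) u) =
    lin_precomp (W := fib (F N) y) (fun i' u' => defect_bracket N i' j y u' v) u
    - lin_precomp (W := fib (F N) y) (fun i' u' => boundary H i' j y u' v) u.
  by move: u v; near: y.
have -> : lin F N y (lin_precomp (W := fib (F N.+1) y)
  (fun j' v' => H' i j' y u v') v) =
    lin_precomp (W := fib (F N) y) (fun j' v' => defect_bracket N i j' y u v') v
    - lin_precomp (W := fib (F N) y) (fun j' v' => boundary H i j' y u v') v.
  by move: u v; near: y.
(* The defect terms cancel, leaving [boundary (boundary H)]. *)
rewrite scalerBr addrACA opprD addrA subrr add0r -opprD opprK.
have HH := @boundary_boundary N H i j y u v.
rewrite -HH// => i' j' ii jj.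
have := near nH0 y; move=> /(_ _ (Ordinal (ii : i' < i.+1)%N)
  (Ordinal (jj : j' < j.+1)%N)).
by apply.
Unshelve. all: by end_near. Qed.

(* The homotopy writes it as a coboundary plus the boundary of H, which vanishes
   on cocycles. *)
Lemma defect_bracket_coboundary i j (u : fib (E i) x) (v : fib (E j) x) :
  u \in cocycle E x i -> v \in cocycle E x j ->
  defect_bracket (i + j) i j x u v \in coboundary F x (i + j).
Proof.
move=> cu cv; have [H [bH cH]] := defect_homotopy (i + j).
have [H' _ lH'] := defect_bracket_lift bH (cH i j erefl).
apply/coboundaryP; exists (H' x u v); rewrite (nbhs_singleton lH').
have H0 i' j' : (forall v, H i' j' x 0 v = 0) /\ (forall u, H i' j' x u 0 = 0).
  have [Hl Hr _] := nbhs_singleton (bH i' j').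
  by split=> w; [exact: (linear_fun0 (Hl w))|exact: (linear_fun0 (Hr w))].
suff -> : boundary H i j x u v = 0 by rewrite subr0.
rewrite /boundary.
have -> : lin_precomp (W := fib (F (i + j)%N) x) (fun i' u' => H i' j x u' v) u
  = 0.
  move: (i + j)%N H {bH cH H' lH'} H0 => N H H0.
  case: i u cu H0 => [//|i] u /cocycleSP /= -> H0; exact: (H0 _ _).1.
have -> : lin_precomp (W := fib (F (i + j)%N) x) (fun j' v' => H i j' x u v') v
  = 0.
  move: (i + j)%N H {bH cH H' lH'} H0 => N H H0.
  case: j v cv H0 => [//|j] v /cocycleSP /= -> H0; exact: (H0 _ _).2.
by rewrite scaler0 addr0.
Qed.

End Homotopy.
End DefectBracket.

Section BracketComparison.
Context {R : realType} {c : geometry} {n : nat} {M : manifold R c n}.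
Local Notation K := (scalars R c).
Variables (E F : lie_infty_algebroid M) (D : vfop M -> M -> Prop).
Variable f : forall i y, fib (E i) y -> fib (F i) y.
Arguments f : clear implicits.

Lemma defect_coboundary x i j (u : fib (E i) x) (v : fib (E j) x) :
  universal_resolving F D -> chain_map f x ->
  u \in cocycle E x i -> v \in cocycle E x j ->
  exists2 w, w \in coboundary F x (i + j) &
    forall al, covector (i + j) al x ->
      defect f al x [:: hv u; hv v] = al x [:: hv w].
Proof.
move=> uF cf cu cv; have [r [e [co nf]]] := local_frames F x.
have gx p : adapted f e co p x by split=> [|k _];
  [exact: chain_map_upto|exact: nf].
exists (defect_bracket f e co (i + j) u v).
  exact: (defect_bracket_coboundary uF gx cu cv).
by move=> al cal; apply: defect_bracketP (gx _) cal.1.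
Qed.

End BracketComparison.

(** * The holonomy bracket *)

Section HolonomyBracket.
Context {R : realType} {c : geometry} {n : nat} {M : manifold R c n}.
Local Notation K := (scalars R c).
Variable E : lie_infty_algebroid M.
Implicit Types (x y : M) (xi eta al : gfun E).

Lemma cocycle_null x i (u : fib (E i) x) : u \in cocycle E x i -> null_anchor u.
Proof. by case: i u => [|i] u; [move/cocycle0P|move=> _ g; apply: rho_pos]. Qed.

Lemma cocycle_lin_precomp x i (u : fib (E i) x) (W : zmodType)
    (G : forall i, fib (E i) x -> W) :
  u \in cocycle E x i -> (forall i, G i 0 = 0) -> lin_precomp G u = 0.
Proof. by case: i u => [//|i] u /cocycleSP /= ->. Qed.

(** On cocycles the differential terms of [Q_null_anchor] drop out for every xi of degree p.+1.
    Taking xi in the image of Q, where Q^2 = 0, shows that w is a cocycle. *)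
Lemma cocycle_bracket x i j (u : fib (E i) x) (v : fib (E j) x) p :
  u \in cocycle E x i -> v \in cocycle E x j -> exists2 w, w \in cocycle E x p &
  forall al, covector p al x -> Q E al x [:: hv u; hv v] = al x [:: hv w].
Proof.
move=> cu cv.
have [w wP] := Q_null_anchor p (cocycle_null cu) (cocycle_null cv).
have wP' xi : gf p.+1 xi x -> Q E xi x [:: hv u; hv v] = xi x [:: hv w].
  move=> gx; have [mx _ _ _] := gf_at gx; rewrite (wP _ gx).
  rewrite !cocycle_lin_precomp ?mulr0 ?addr0// => k.
    exact: (multilinear_form0 [:: hv u] [::] k mx).
  exact: (multilinear_form0 [::] [:: hv v] k mx).
exists w => [|al cal]; last exact: wP' cal.1.
case: p w {wP} wP' => [|p] w wP'.
  apply/cocycle0P => g rg; have gg := gf_gf_of_fun E rg.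
  by rewrite /rho -(wP' _ (Q_deg (l := E) gg)) (QQ _ gg).
apply/cocycleSP/covector_sep => al cal.
have [mal _ _ _] := gf_at cal.1; rewrite (multilinear_form0 [::] [::] _ mal).
have := wP' _ (Q_deg (l := E) cal.1); rewrite (QQ _ cal.1) (Q_covector1 _ cal)
  /=.
by move/esym/eqP; rewrite mulf_eq0 signr_eq0 => /eqP.
Qed.

(** Q^2 = 0 evaluated on r and v: bracketing a boundary with a cocycle gives, up to sign, the
    boundary of the bracket of r with v. *)
Lemma bracket_coboundaryl x i j (r : fib (E i.+1) x) (v : fib (E j) x) p :
  v \in cocycle E x j -> exists w, forall al, covector p al x ->
    Q E al x [:: hv (lin E i x r); hv v] = al x [:: hv (lin E p x w)].
Proof.
move=> cv; have [w wP] := Q_null_anchor p.+1 (rho_pos r) (cocycle_null cv).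
exists ((-1) ^+ (i + p).+1 *: w) => al cal; have [mal _ _ _] := gf_at cal.1.
have gQ := Q_deg (l := E) cal.1; have [mQ _ _ _] := gf_at gQ.
have := wP _ gQ; rewrite (QQ _ cal.1) (Q_covector1 _ cal) /=.
rewrite cocycle_lin_precomp ?mulr0 ?addr0//; last first.
  by move=> k; apply: (multilinear_form0 [:: hv r] [::] _ mQ).
rewrite linearZ /= (multilinear_formZ [::] [::] _ _ mal) /=.
move: (al x _) (Q E al x _) => a b /eqP.
rewrite eq_sym addr_eq0 => /eqP e.
have {}e : (-1) ^+ i.+1 * b = - ((-1) ^+ p.+1 * a) by rewrite e opprK.
by rewrite -[b](signrMK i.+1) e !exprS exprD; ring.
Qed.

Lemma bracket_coboundaryr x i j (u : fib (E i) x) (r : fib (E j.+1) x) p :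
  u \in cocycle E x i -> exists w, forall al, covector p al x ->
    Q E al x [:: hv u; hv (lin E j x r)] = al x [:: hv (lin E p x w)].
Proof.
move=> cu; have [w wP] := bracket_coboundaryl r p cu.
exists ((-1) ^+ (i.+1 * j.+1) *: w) => al cal; have [mal _ _ _] := gf_at cal.1.
have [_ sQ _ _] := gf_at (Q_deg (l := E) cal.1).
rewrite (sQ [::] [::]) /= wP// linearZ /=.
by rewrite (multilinear_formZ [::] [::] _ _ mal).
Qed.

(* the sign produced by the two graded commutators of [bracket] when the anchor
   terms vanish *)
Definition bracket_sign i j : K := (-1) ^+ ((1 + i.+1) * j.+1) * (-1) ^+
  (1 * i.+1).

(** A contracted covector is a function, so this is an anchor term of the derived bracket. *)
Lemma Q_contract k al x j (t : forall y, fib (E j) y) i (u : fib (E i) x) :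
  covector k al x -> vreg t x -> null_anchor u ->
  Q E (contract (existT _ j t) al) x [:: hv u] = 0.
Proof.
move=> cal rt u0.
have rg : reg (fun z => al z [:: hv (t z)]) x.
  by have [_ _ _ ral] := gf_at cal.1; apply: (ral [:: existT _ j t]).
have gg := gf_gf_of_fun E rg.
have e : \forall y \near x, gf_eq_at (gf_of_fun E (fun z => al z [:: hv (t z)]))
    (contract (existT _ j t) al) y.
  apply: filterS (covector_near cal) => y /covector_arity1 a1 [|h l] //=.
  by rewrite /Defs.contract a1.
by rewrite -(Q_germ (l := E) gg (gf_germ gg e) e) -/(rho u _) u0.
Qed.

Lemma comm_contract_cocycle i j (s : forall y, fib (E i) y)
    (t : forall y, fib (E j) y) x k al :
  vreg s x -> vreg t x -> s x \in cocycle E x i -> t x \in cocycle E x j ->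
  covector k al x ->
  comm_contract (1 + i.+1) (comm_contract 1 (Q E) (existT _ i s)) (existT _ j t)
    al x [::] = bracket_sign i j * Q E al x [:: hv (s x); hv (t x)].
Proof.
move=> rs rt cs ct cal.
pose s' : hsec E := existT _ i s; pose t' : hsec E := existT _ j t.
have st0 : \forall y \near x,
    gf_eq_at (gf_of_fun E (fun=> 0)) (contract s' (contract t' al)) y.
  apply: filterS (covector_near cal) => y /covector_arity1 a1 h.
  by rewrite /Defs.contract a1//; case: h.
(* The first term is Q of 0, since al has arity 1; the next two are anchor terms. *)
transitivity (Q E (contract s' (contract t' al)) x [::]
  - (-1) ^+ (1 * i.+1) * Q E (contract t' al) x [:: hv (s x)]
  - (-1) ^+ ((1 + i.+1) * j.+1) * (Q E (contract s' al) x [:: hv (t x)]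
    - (-1) ^+ (1 * i.+1) * Q E al x [:: hv (s x); hv (t x)])) => //.
rewrite (Q_contract cal rt (cocycle_null cs))
  (Q_contract cal rs (cocycle_null ct)).
rewrite (Q_eq0 (gf_germ (gf0 E 0 x) st0)) /bracket_sign; first by ring.
by apply: filterS st0 => y e l; rewrite -e; case: l.
Qed.

Lemma bracketP i j (s : forall y, fib (E i) y) (t : forall y, fib (E j) y) x
    (w : fib (E (i + j)%N) x) :
  vreg s x -> vreg t x -> s x \in cocycle E x i -> t x \in cocycle E x j ->
  (forall al, covector (i + j) al x ->
    bracket_sign i j * Q E al x [:: hv (s x); hv (t x)] = al x [:: hv w]) ->
  bracket s t x = w.
Proof.
move=> rs rt cs ct wP; apply: xget_unique => [al cal|w' w'P].
  by rewrite (comm_contract_cocycle rs rt cs ct cal) wP.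
apply: covector_sep => al cal; rewrite -wP//.
by rewrite -(comm_contract_cocycle rs rt cs ct cal); apply/esym/w'P.
Qed.

Lemma cls_coboundary x i (u v : subspace (cocycle E x i)) :
  cls (coboundary E x i) u = cls (coboundary E x i) v <->
  val u - val v \in coboundary E x i.
Proof.
have uvE : (u - v \in sub_pred (coboundary E x i))
    = (val u - val v \in coboundary E x i) by rewrite -raddfB.
by split=> [/eqP|uv]; [|apply/eqP]; rewrite cls_eq uvE.
Qed.

Lemma hol_bracketP x i j (u : subspace (cocycle E x i))
    (v : subspace (cocycle E x j)) (w : subspace (cocycle E x (i + j)%N)) :
  (forall al, covector (i + j) al x ->
    bracket_sign i j * Q E al x [:: hv (val u); hv (val v)] = al x
      [:: hv (val w)]) ->
  hol_bracket (cls (coboundary E x i) u) (cls (coboundary E x j) v)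
  = cls (coboundary E x (i + j)%N) w.
Proof.
move=> wP; apply: xget_unique.
  have [s rs su] := section_through (val u); have [t rt tv] :=
    section_through (val v).
  exists s, t, u, v, w; split=> //.
  by apply/esym/bracketP => //; rewrite ?su ?tv //; apply: valP.
move=> d [s [t [u' [v' [w' [[rs rt] [us vt] ww
  [/cls_coboundary uu /cls_coboundary vv] ->]]]]]].
apply/cls_coboundary.
have [r ur] := (coboundaryP _).1 uu; have [q vq] := (coboundaryP _).1 vv.
have [w1 w1P] := bracket_coboundaryl r (i + j) (valP v).
have [w2 w2P] := bracket_coboundaryr q (i + j) (valP u').
have [w0 _ w0P] := cocycle_bracket (i + j) (valP u') (valP v').
have w'E : val w' = bracket_sign i j *: w0.
  rewrite ww; apply: bracketP => //; rewrite -?us -?vt;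
    [exact: valP|exact: valP|].
  move=> al cal; have [mal _ _ _] := gf_at cal.1.
  by rewrite (multilinear_formZ [::] [::] _ _ mal) w0P.
(* One slot is changed at a time: w1 accounts for replacing u by u', w2 for replacing v by v'. *)
apply/coboundaryP; exists (- bracket_sign i j *: (w1 + w2)).
apply: covector_sep => al cal; have [mal _ _ _] := gf_at cal.1.
have [mQ _ _ _] := gf_at (Q_deg (l := E) cal.1).
rewrite linearZ linearD /= (multilinear_formZ [::] [::] _ _ mal) /=.
rewrite -[lin E _ x w1]scale1r (mal [::] [::]) /= mul1r -w1P// -w2P//.
rewrite addrC -scaleN1r (mal [::] [::]) /= -wP// w'E.
rewrite (multilinear_formZ [::] [::] _ _ mal) /= -w0P// -ur -vq.
rewrite ![val _ - val _]addrC -!scaleN1r (mQ [::] [:: _]) (mQ [:: _] [::]) /=.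
by ring.
Qed.

End HolonomyBracket.

(** * Induced maps on the holonomy *)

Section InducedMap.
Context {R : realType} {c : geometry} {n : nat} {M : manifold R c n}.
Local Notation K := (scalars R c).
Implicit Types (x y : M) (E F : lie_infty_algebroid M).

(** Quantifying over w keeps the proof that the image is a cocycle out of the formula. *)
Lemma induced_map E F (f : forall i y, fib (E i) y -> fib (F i) y) x i :
  chain_map f x -> exists phi : {linear hol E x i -> hol F x i},
  forall (u : subspace (cocycle E x i)) (w : subspace (cocycle F x i)),
    val w = f i x (val u) ->
    phi (cls (coboundary E x i) u) = cls (coboundary F x i) w.
Proof.
move=> cf; have lf := @chain_map_linear _ _ _ _ _ _ _ _ cf i.
pose g (u : subspace (cocycle E x i)) : subspace (cocycle F x i) :=
  Sub (f i x (val u)) (chain_map_cocycle cf (valP u)).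
pose phi0 (q : hol E x i) : hol F x i := cls (coboundary F x i) (g (repr q)).
have fB u v : f i x (u - v) = f i x u - f i x v.
  by have := lf (-1) v u; rewrite !scaleN1r !(addrC (- _)).
have phi0E u w : val w = f i x (val u) ->
    phi0 (cls (coboundary E x i) u) = cls (coboundary F x i) w.
  move=> wE; apply/cls_coboundary; rewrite wE SubK -fB.
  apply: (chain_map_coboundary cf); apply/cls_coboundary.
  by rewrite /cls reprK.
have phi0_linear : linear phi0.
  move=> a p q; have [u ->] := cls_surj p; have [v ->] := cls_surj q.
  rewrite (_ : a *: cls _ u = cls _ (a *: u)); last exact: sq_scale_cls.
  rewrite -clsD (phi0E _ (a *: g u + g v)); last first.
    by rewrite [LHS]linearP [in RHS]linearP lf.
  rewrite (phi0E u (g u)) ?SubK// (phi0E v (g v)) ?SubK//.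
  by rewrite clsD; congr (_ + _); apply/esym/sq_scale_cls.
pose phi : {linear hol E x i -> hol F x i} :=
  HB.pack phi0 (GRing.isLinear.Build _ _ _ _ phi0 phi0_linear).
by exists phi.
Qed.

End InducedMap.

(** * The linear part of a morphism as a chain map *)

Section MorphismLinearPart.
Context {R : realType} {c : geometry} {n : nat} {M : manifold R c n}.
Local Notation K := (scalars R c).
Variables (E F : lie_infty_algebroid M) (U : set M) (Phi : gfun F -> gfun E).
Arguments Phi : clear implicits.
Hypotheses (oU : open U) (mPhi : morphism_on U E F Phi).
Implicit Types (x y : M) (xi eta al : gfun F).

Lemma morphism0 y l : U y -> Phi (gf_of_fun F (fun=> 0)) y l = 0.
Proof.
move=> Uy.
have := mor_lin mPhi Uy (reg_cst (-1) y) (gf0 F 0 y) (gf0 F 0 y) l.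
rewrite (_ : gf_lin _ _ _ = gf_of_fun F (fun=> 0)); last first.
  apply: functional_extensionality_dep => z; apply/funext => s.
  by rewrite /gf_lin mulN1r addNr; case: s.
by rewrite /gf_lin mulN1r addNr.
Qed.

Lemma morphism_fun g y : U y -> reg g y ->
  gf_eq_at (Phi (gf_of_fun F g)) (gf_of_fun E g) y.
Proof.
move=> Uy rg l.
have g1 := gf_gf_of_fun F (reg_cst 1 y).
have := mor_lin mPhi Uy rg g1 (gf0 F 0 y) l.
rewrite (_ : gf_lin _ _ _ = gf_of_fun F g); last first.
  apply: functional_extensionality_dep => z; apply/funext => s.
  by rewrite /gf_lin; case: s => [|h s] /=; rewrite ?mulr1 ?mulr0 addr0.
move=> ->; rewrite /gf_lin morphism0// addr0 (mor_one mPhi Uy).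
by case: l => [|h l] /=; rewrite ?mulr1 ?mulr0.
Qed.

Lemma morphism_gf0_nil eta y : U y -> gf 0 eta y -> Phi eta y [::] = eta y [::].
Proof.
move=> Uy ge.
have ne : \forall z \near y, gf_eq_at eta (gf_of_fun F (fun w => eta w [::])) z.
  apply: filterS (gf_near ge) => z /gf_at[_ _ dz _] [|h l]//=.
  by apply: dz; rewrite big_cons.
rewrite (mor_germ mPhi Uy ge (gf_germ ge ne) ne).
by rewrite morphism_fun//; exact: gf_reg0 ge.
Qed.

Section Frames.
Variables (r : nat -> nat) (e : forall i, 'I_(r i) -> forall y, fib (F i) y).
Variable (co : forall i, 'I_(r i) -> forall y, fib (F i) y -> K).
Arguments e : clear implicits.
Arguments co : clear implicits.

Definition morphism_lin i y (v : fib (E i) y) : fib (F i) y :=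
  \sum_l Phi (dual_gfun (co i l)) y [:: hv v] *: e i l y.
Arguments morphism_lin : clear implicits.

(** By multiplicativity, the arity 1 part of Phi(xi) depends only on that of xi. The statement is
    needed for xi = Q(al), not only for covectors. *)
Lemma morphism_linP i y xi (v : fib (E i) y) : U y ->
  (forall q, (q < i.+1)%N -> \forall z \near y, frame_at (e q) (co q) z) ->
  gf i.+1 xi y -> Phi xi y [:: hv v] = xi y [:: hv (morphism_lin i y v)].
Proof.
move=> Uy nf /(gf_ge1 (k := i.+1) isT); move: xi.
apply: (gf_frame_ind (e := e) (co := co)) => //.
- move=> xi eta gx ge nxe; have /gf_eqP xe := nbhs_singleton nxe.
  by rewrite -xe => <-; rewrite (mor_germ mPhi Uy gx ge nxe).
- by rewrite morphism0.
- move=> xi eta gx ge Px Pe.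
  by rewrite (mor_lin mPhi Uy (reg_cst 1 y) gx ge) /gf_lin Px Pe.
- move=> q s l eta pqs [ge _].
  have qi : (q < i.+1)%N by lia.
  have cal := dual_frame_covector l (nf q qi).
  rewrite (mor_mul mPhi Uy cal.1 ge) /gmul.
  rewrite (fmul1 _ _ _ (gf_nil (mor_deg mPhi Uy cal.1))).
  rewrite (fmul1 _ _ _ (covector_nil cal)).
  case: s pqs ge => [|s] pqs ge.
    move: pqs; rewrite addn0 => -[iq]; subst q.
    rewrite morphism_gf0_nil//; congr (_ * _).
    rewrite {2}/dual_gfun dual_form1 /morphism_lin.
    by rewrite (frame_coord _ _ (nbhs_singleton (nf i qi))).
  by rewrite (gf_nil ge) (gf_nil (mor_deg mPhi Uy ge)) !mulr0.
Qed.

(** Commutation with Q in arity 1: on covectors it gives the differential, on functions the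
    anchor. *)
Lemma morphism_chain_map x : U x ->
  (forall i, \forall y \near x, frame_at (e i) (co i) y) ->
  chain_map morphism_lin x.
Proof.
move=> Ux nf; have nU : \forall y \near x, U y by apply: open_nbhs_nbhs.
have nfp p : \forall y \near x, U y /\
    forall q, (q < p)%N -> \forall z \near y, frame_at (e q) (co q) z.
  apply: filterI => //.
  have : \forall y \near x, forall q : 'I_p, \forall z \near y,
    frame_at (e q) (co q) z.
    by apply: filter_forall => q; apply: near_join; exact: nf.
  by apply: filterS => y fy q qp; exact: (fy (Ordinal qp)).
split=> [i|i|].
- apply: filterS (nfp i.+1) => y [Uy fy].
  have gd l : gf i.+1 (Phi (dual_gfun (co i l))) y.
    by apply: (mor_deg mPhi Uy); case: (dual_frame_covector l (fy i (leqnn _))).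
  split=> [a u v|s rs].
    rewrite scaler_sumr -big_split; apply: eq_bigr => l _ /=.
    have [md _ _ _] := gf_at (gd l).
    by rewrite (md [::] [::]) /= scalerDl scalerA.
  apply: (@vreg_sum _ _ _ _ _ _ _ (fun l z =>
      Phi (dual_gfun (co i l)) z [:: hv (s z)]) (fun l => e i l)) => l.
    by have [_ _ _ rd] := gf_at (gd l); apply: (rd [:: existT _ i s]).
  exact: frame_sec (nbhs_singleton (fy i (leqnn _))) l.
- apply: filterS (nfp i.+2) => y [Uy fy] v.
  have fy' q : (q < i.+1)%N -> \forall z \near y, frame_at (e q) (co q) z.
    by move=> qi; apply: fy; exact: ltnW.
  apply: covector_sep => al cal.
  have gQ := Q_deg (l := F) cal.1.
  have := morphism_linP v Uy fy gQ.
  rewrite (Q_covector1 _ cal) -(mor_Q mPhi Uy cal.1).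
  rewrite (Q1_pos _ (mor_deg mPhi Uy cal.1)) /= (morphism_linP _ Uy fy' cal.1).
  by move/(can_inj (signrMK _)).
- apply: filterS (nfp 1) => y [Uy fy] v g rg.
  have gg := gf_gf_of_fun F rg.
  rewrite /rho -(morphism_linP v Uy fy (Q_deg (l := F) gg)) -(mor_Q mPhi Uy gg).
  apply: (Q_germ (l := E) (mor_deg mPhi Uy gg) (gf_gf_of_fun E rg)).
  have nUy : \forall z \near y, U z by apply: open_nbhs_nbhs.
  by apply: filterS2 nUy (reg_near rg) => z; apply: morphism_fun.
Qed.

End Frames.

Lemma morphism_linear_part x : U x ->
  exists2 f : forall i y, fib (E i) y -> fib (F i) y, chain_map f x &
    forall i (v : fib (E i) x), linear_part Phi v (f i x v).
Proof.
move=> Ux; have [r [e [co nf]]] := local_frames F x.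
exists (morphism_lin e co); first exact: morphism_chain_map.
by move=> i v al cal; apply: morphism_linP cal.1.
Qed.

End MorphismLinearPart.

(** * The isomorphism, its bracket and its independence of choices *)

Section HolonomyIsomorphism.
Context {R : realType} {c : geometry} {n : nat} {M : manifold R c n}.
Local Notation K := (scalars R c).
Variables (D : vfop M -> M -> Prop) (x : M).
Implicit Types (E F : lie_infty_algebroid M).

Definition induces E F (f : forall i y, fib (E i) y -> fib (F i) y)
    (phi : forall i, hol E x i -> hol F x i) :=
  forall i (u : subspace (cocycle E x i)) (w : subspace (cocycle F x i)),
    val w = f i x (val u) ->
    phi i (cls (coboundary E x i) u) = cls (coboundary F x i) w.

Lemma induces_cancel E F (f : forall i y, fib (E i) y -> fib (F i) y)
    (g : forall i y, fib (F i) y -> fib (E i) y) phi psi :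
  universal_resolving E D -> chain_map f x -> chain_map g x ->
  induces f phi -> induces g psi -> forall i, cancel (phi i) (psi i).
Proof.
move=> uE cf cg If Ig i q; have [u ->] := cls_surj q.
pose v : subspace (cocycle F x i) := Sub (f i x (val u))
  (chain_map_cocycle cf (valP u)).
pose w : subspace (cocycle E x i) := Sub (g i x (val v))
  (chain_map_cocycle cg (valP v)).
rewrite (If i u v)// (Ig i v w)//; apply/cls_coboundary.
by have := chain_homotopy uE (chain_map_comp cf cg) (chain_map_id E x) (valP u).
Qed.

Lemma induces_bracket E F (f : forall i y, fib (E i) y -> fib (F i) y) phi :
  universal_resolving F D -> chain_map f x -> induces f phi ->
  forall i j (a : hol E x i) (b : hol E x j),
    phi (i + j)%N (hol_bracket a b) = hol_bracket (phi i a) (phi j b).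
Proof.
move=> uF cf If i j a b; have [u ->] := cls_surj a; have [v ->] := cls_surj b.
pose fu : subspace (cocycle F x i) := Sub (f i x (val u))
  (chain_map_cocycle cf (valP u)).
pose fv : subspace (cocycle F x j) := Sub (f j x (val v))
  (chain_map_cocycle cf (valP v)).
have [w0 cw w0P] := cocycle_bracket (i + j) (valP u) (valP v).
have [w1 cw' w1P] := cocycle_bracket (i + j) (valP fu) (valP fv).
pose s := bracket_sign (R := R) (c := c) i j.
pose w : subspace (cocycle E x (i + j)) := s *: Sub w0 cw.
pose w' : subspace (cocycle F x (i + j)) := s *: Sub w1 cw'.
pose fw : subspace (cocycle F x (i + j)) :=
  Sub (f (i + j)%N x (val w)) (chain_map_cocycle cf (valP w)).
rewrite (If _ _ fu)// (If _ _ fv)// (@hol_bracketP _ _ _ _ _ _ _ _ _ _ w);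
  last first.
  move=> al cal; have [mal _ _ _] := gf_at cal.1.
  by rewrite linearZ (multilinear_formZ [::] [::] _ _ mal) w0P.
rewrite (@hol_bracketP _ _ _ _ _ _ _ _ _ _ w'); last first.
  move=> al cal; have [mal _ _ _] := gf_at cal.1.
  by rewrite linearZ (multilinear_formZ [::] [::] _ _ mal) w1P.
rewrite (If _ _ fw)//; apply/cls_coboundary.
have [z cz zP] := defect_coboundary uF cf (valP u) (valP v).
have -> : val w' = s *: w1 by rewrite linearZ.
have wE : val w = s *: w0 by rewrite linearZ.
have -> : val fw = f (i + j)%N x (s *: w0) by rewrite -wE.
(* Paired with al, z is Q_F(al) on (f u, f v) minus Q_E of the pullback of al on (u, v), so z equals
   w1 minus the image of w0. *)
suff -> : f (i + j)%N x (s *: w0) - s *: w1 = - s *: z by apply: rpredZ.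
apply: covector_sep => al cal; have [mal _ _ _] := gf_at cal.1.
have [mpal _ _ _] :=
  gf_at (pull_covector (chain_map_upto (i + j).+1 cf) (leqnn _) cal).1.
rewrite (multilinear_formZ [::] [::] _ _ mal) /= -zP// defectE.
rewrite addrC -scaleN1r (mal [::] [::]) /= (multilinear_formZ [::] [::] _ _ mal)
  /=.
rewrite -w1P// -[al x [:: hv (f _ x _)]]/(pull f al x [:: hv (s *: w0)]).
rewrite (multilinear_formZ [::] [::] _ _ mpal) /= -w0P; last first.
  exact: pull_covector (chain_map_upto (i + j).+1 cf) (leqnn _) cal.
by rewrite /push /=; ring.
Qed.

(** The linear part of Phi is another chain map over D, hence homotopic to f however f was
    chosen. *)
Lemma induces_morphism E F (f : forall i y, fib (E i) y -> fib (F i) y) phi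
    (U : set M) (Phi : gfun F -> gfun E) :
  universal_resolving F D -> chain_map f x -> induces f phi ->
  open U -> U x -> morphism_on U E F Phi -> induced_by E F Phi x phi.
Proof.
move=> uF cf If oU Ux mPhi i u.
have [f' cf' f'P] := morphism_linear_part oU mPhi Ux.
pose w : subspace (cocycle F x i) := Sub (f' i x (val u))
  (chain_map_cocycle cf' (valP u)).
pose fu : subspace (cocycle F x i) := Sub (f i x (val u))
  (chain_map_cocycle cf (valP u)).
exists w; first exact: f'P.
rewrite (If i u fu)//; apply/cls_coboundary.
exact: chain_homotopy uF cf cf' (valP u).
Qed.

End HolonomyIsomorphism.

Theorem proposition2p3p3 (R : realType) (c : geometry) (n : nat)
    (M : manifold R c n) (D : vfop M -> M -> Prop) (hD : hermann_foliation D)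
    (E F : lie_infty_algebroid M)
    (hE : universal_resolving E D) (hF : universal_resolving F D) (x : M) :
  exists (phi : forall i : nat, {linear hol E x i -> hol F x i})
         (psi : forall i : nat, {linear hol F x i -> hol E x i}),
    (forall i, cancel (phi i) (psi i) /\ cancel (psi i) (phi i)) /\
    (forall i j (a : hol E x i) (b : hol E x j),
       phi (i + j)%N (hol_bracket a b) = hol_bracket (phi i a) (phi j b)) /\
    (forall (U : set M) (Phi : gfun F -> gfun E), open U -> U x ->
       morphism_on U E F Phi -> induced_by E F Phi x (fun i => phi i)) /\
    (forall (U : set M) (Psi : gfun E -> gfun F), open U -> U x ->
       morphism_on U F E Psi -> induced_by F E Psi x (fun i => psi i)).
Proof.
have [f cf] := chain_map_exists x hE hF; have [g cg] :=
  chain_map_exists x hF hE.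
pose phi i := sval (cid (induced_map i cf)).
pose psi i := sval (cid (induced_map i cg)).
have If : induces f (fun i => phi i).
  by move=> i; exact: (svalP (cid (induced_map i cf))).
have Ig : induces g (fun i => psi i).
  by move=> i; exact: (svalP (cid (induced_map i cg))).
exists phi, psi; split; [|split; [|split]].
- move=> i; split; first exact: (induces_cancel hE cf cg If Ig).
  exact: (induces_cancel hF cg cf Ig If).
- exact: (induces_bracket hF cf If).
- by move=> U Phi; apply: induces_morphism hF cf If.
- by move=> U Psi; apply: induces_morphism hE cg Ig.
Qed.
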